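(* Fix integers $k\ge 1$ and $N>4k$ (independent of $n$). There exist constants $c>0$ and $n_0$ such that for every $n\ge n_0$ there are orthogonal matrices $O^{(1)},\dots,O^{(N)}\in O(2n)$ with the following property: for every $S\in\mathcal S_{2k}$ there exist $r\in[N]$ and $R\in\mathcal D_{2k}$ with $|\det(O^{(r)}_{R,S})|\ge c\, n^{-k/2}$. Consequently the POVM $\mathsf G(r,\mathbf q,X)=\frac1N\mathsf G^{O^{(r)}}(\mathbf q,X)$ (outcomes $r\in[N]$, $\mathbf q\in\{\pm1\}^n$, $X\subseteq[2n]$) is a joint measurement (parent POVM) of all unsharp observables $\mathsf M^{\eta}_S$, $S\in\mathcal S_{2k}$, with a common sharpness $\eta=\Omega(n^{-k/2})$, i.e. $\eta_{2k}=\Omega(n^{-k/2})$. For $k=1$ the same conclusion holds already with $N=2$ orthogonal matrices.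
   Context: Fix $n\ge1$ and let $\gamma_1,\dots,\gamma_{2n}$ be Majorana operators on $\mathcal H=(\mathbb C^2)^{\otimes n}$: Hermitian operators with $\gamma_j\gamma_{j'}+\gamma_{j'}\gamma_j=2\delta_{jj'}I$. For $S=\{j_1<\dots<j_m\}\subseteq[2n]$ put $\gamma_S=i^{\binom m2}\gamma_{j_1}\cdots\gamma_{j_m}$ ($\gamma_\emptyset=I$); $\mathcal S_m=\{S\subseteq[2n]:|S|=m\}$. Let $\mathcal D_2=\{\{2j-1,2j\}:j\in[n]\}$ and $\mathcal D_{2k}$ the set of unions of $k$ distinct elements of $\mathcal D_2$; for $R=R_1\cup\dots\cup R_k\in\mathcal D_{2k}$ ($R_i\in\mathcal D_2$) and $\mathbf q=(q_{R'})_{R'\in\mathcal D_2}\in\{\pm1\}^n$ set $q_R=\prod_i q_{R_i}$. For $O\in O(2n)$ and equal-size index sets $R,S$, $O_{R,S}$ is the submatrix with rows $R$ and columns $S$ (in increasing order). For $X,S\subseteq[2n]$ let $x_S=(-1)^{|X||S|-|S\cap X|}$. For $R\in\mathcal D_{2k}$ let $\gamma_R^{O,X}=\sum_{S\in\mathcal S_{2k}}x_S\det(O_{R,S})\gamma_S$ and $\mathsf G^O_R(q,X)=2^{-2n-1}(I+q\gamma_R^{O,X})$, $q\in\{\pm1\}$. Define $\mathsf G^O(\mathbf q,X)=(2^{2n})^{n-1}\prod_{R\in\mathcal D_2}\mathsf G^O_R(q_R,X)$ for $\mathbf q\in\{\pm1\}^n$, $X\subseteq[2n]$ (the factors commute).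 Unsharp Majorana observable with sharpness $\eta\in[0,1]$: $\mathsf M^\eta_S(e)=\frac12(I+e\eta\gamma_S)$, $e\in\{\pm1\}$. A finite family of POVMs $\mathsf M_j$ is jointly measured by a POVM $\mathsf G$ with finite outcome set $\Lambda$ if there are stochastic maps $D(e|j,\lambda)\ge0$, $\sum_eD(e|j,\lambda)=1$, with $\mathsf M_j(e)=\sum_\lambda D(e|j,\lambda)\mathsf G(\lambda)$ for all $j,e$. $\eta_{2k}$ denotes the largest $\eta$ such that $\mathsf G$ jointly measures all $\mathsf M^{\eta}_S$, $S\in\mathcal S_{2k}$. *)

(* Defs.v *)
From HB Require Import structures.
From mathcomp Require Import all_boot all_order all_algebra.
From mathcomp Require Import reals.
From mathcomp Require Import complex.
Set Implicit Arguments. Unset Strict Implicit. Unset Printing Implicit Defensive.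
Import Order.TTheory GRing.Theory Num.Theory.
Local Open Scope ring_scope.
Local Open Scope complex_scope.

Section MajoranaDefs.
Variable R : realType.
Local Notation C := (R[i]).

Definition adjmx (m p : nat) (A : 'M[C]_(m, p)) : 'M[C]_(p, m) :=
  (map_mx Num.conj A)^T.

Definition herm_mx (d : nat) (A : 'M[C]_d) : Prop := adjmx A = A.

Definition psd_mx (d : nat) (A : 'M[C]_d) : Prop :=
  herm_mx A /\ forall v : 'cV[C]_d, 0 <= (adjmx v *m A *m v) 0 0.

Definition majorana (n : nat) (gamma : 'I_(2 * n) -> 'M[C]_(2 ^ n)) : Prop :=
  (forall j, herm_mx (gamma j)) /\
  (forall j j', gamma j *m gamma j' + gamma j' *m gamma j
                = ((2 * (j == j'))%:R)%:M).

(* gamma_S = i^(binom |S| 2) gamma_{j1} ... gamma_{jm}, j1 < ... < jm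
   (enum S lists the elements of S in increasing order) *)
Definition gammaS (n : nat) (gamma : 'I_(2 * n) -> 'M[C]_(2 ^ n))
  (S : {set 'I_(2 * n)}) : 'M[C]_(2 ^ n) :=
  ('i ^+ 'C(#|S|, 2)) *: \prod_(j <- enum S) gamma j.

Definition orth_mx (m : nat) (O : 'M[R]_m) : Prop := O *m O^T = 1%:M.

(* det(O_{Rs,Ss}): minor_mx with rows Rs and columns Ss (increasing order);
   meaningful when #|Rs| = #|Ss| (the default of nth is never used then) *)
Definition minor_mx (m : nat) (O : 'M[R]_m) (Rs Ss : {set 'I_m}) : R :=
  \det (\matrix_(a < #|Rs|, b < #|Rs|)
          O (enum_val a) (nth (enum_val a) (enum Ss) b)).

(* the pair {2j-1, 2j} of D_2 (0-based: {2j, 2j+1}) *)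
Definition pairset (n : nat) (j : 'I_n) : {set 'I_(2 * n)} :=
  [set a : 'I_(2 * n) | a./2 == j].

Definition inD (n k : nat) (Rs : {set 'I_(2 * n)}) : Prop :=
  exists J : {set 'I_n}, #|J| = k /\ Rs = \bigcup_(j in J) pairset j.

Definition sgnb (b : bool) : C := if b then 1 else -1.

Definition xS (n : nat) (X S : {set 'I_(2 * n)}) : C :=
  (-1) ^+ (#|X| * #|S| - #|S :&: X|).

Definition gammaROX (n : nat) (gamma : 'I_(2 * n) -> 'M[C]_(2 ^ n))
  (O : 'M[R]_(2 * n)) (X Rs : {set 'I_(2 * n)}) : 'M[C]_(2 ^ n) :=
  \sum_(S : {set 'I_(2 * n)} | #|S| == #|Rs|)
     (xS X S * (minor_mx O Rs S)%:C) *: gammaS gamma S.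

Definition GR (n : nat) (gamma : 'I_(2 * n) -> 'M[C]_(2 ^ n))
  (O : 'M[R]_(2 * n)) (Rs : {set 'I_(2 * n)}) (q : bool)
  (X : {set 'I_(2 * n)}) : 'M[C]_(2 ^ n) :=
  ((2 ^ (2 * n + 1))%:R)^-1 *: (1%:M + sgnb q *: gammaROX gamma O X Rs).

Definition GO (n : nat) (gamma : 'I_(2 * n) -> 'M[C]_(2 ^ n))
  (O : 'M[R]_(2 * n)) (q : {ffun 'I_n -> bool}) (X : {set 'I_(2 * n)})
  : 'M[C]_(2 ^ n) :=
  ((2 ^ (2 * n)) ^ (n - 1))%:R *: \prod_(j : 'I_n) GR gamma O (pairset j) (q j) X.

Definition Munsharp (n : nat) (gamma : 'I_(2 * n) -> 'M[C]_(2 ^ n))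
  (eta : R) (S : {set 'I_(2 * n)}) (e : bool) : 'M[C]_(2 ^ n) :=
  2%:R^-1 *: (1%:M + (sgnb e * eta%:C) *: gammaS gamma S).

Definition povm (d : nat) (L : finType) (G : L -> 'M[C]_d) : Prop :=
  (forall l, psd_mx (G l)) /\ \sum_(l : L) G l = 1%:M.

Definition jointly_measures (d : nat) (L I : finType) (G : L -> 'M[C]_d)
  (P : pred I) (M : I -> bool -> 'M[C]_d) : Prop :=
  exists D : I -> L -> bool -> R,
    (forall j l e, P j -> 0 <= D j l e) /\
    (forall j l, P j -> D j l true + D j l false = 1) /\
    (forall j e, P j -> M j e = \sum_(l : L) (D j l e)%:C *: G l).

Definition Gpar (n N : nat) (gamma : 'I_(2 * n) -> 'M[C]_(2 ^ n))
  (O : 'I_N -> 'M[R]_(2 * n))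
  (l : 'I_N * {ffun 'I_n -> bool} * {set 'I_(2 * n)}) : 'M[C]_(2 ^ n) :=
  (N%:R)^-1 *: GO gamma (O l.1.1) l.1.2 l.2.

End MajoranaDefs.

(* Main.v *)
Require Import Defs.
From HB Require Import structures.
From mathcomp Require Import all_boot all_order all_algebra all_fingroup.
From mathcomp Require Import reals.
From mathcomp Require Import complex.
From mathcomp Require Import zify ring lra.
Import Order.TTheory GRing.Theory Num.Theory.
Local Open Scope ring_scope.

(* Joint measurability. For each [X] the operators g_i = sum_b O_ib (-1)^[b in X] gamma_b
   are again Majorana operators, and the factors of G^O(q,X) are, up to normalisation, the
   commuting projections (1 + q_j i g_2j g_2j+1)/2; hence G is a POVM. Expanding
   prod_(i in R) g_i and averaging over X against x_S leaves det(O_RS) gamma_S, so that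
   post-processing by the sign x_S q_R (damped by randomisation) measures gamma_S with
   any sharpness up to |det(O_RS)| / N.

   Large minors. O is block diagonal with Sylvester-Hadamard blocks of size about sqrt n,
   and its rows are ordered so that for any two blocks some R_j consists of one row of
   each. If the elements of S lie in distinct blocks, pairing up these blocks gives a minor
   which is, after reordering, diagonal with entries of size about n^(-1/4). A random
   permutation of the columns fails to separate a given S with probability O(n^(-1/2)), so a
   greedy choice of N > 4k permutations separates all of the at most (2n)^(2k) sets S. For
   k = 1, pairs of Hadamard rows differing in a single index also separate two columns of
   the same block, and two matrices suffice. *)

Set Implicit Arguments. Unset Strict Implicit. Unset Printing Implicit Defensive.

(** * Finite sets and sign characters *)

Lemma imset_full_inj (T : finType) p (f : 'I_p -> T) : #|f @: setT| = p -> injective f.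
Proof.
move=> card_f; have : #|f @: setT| == #|[set: 'I_p]| by rewrite card_f cardsT card_ord.
by move/imset_injP => inj_f i i'; apply: inj_f.
Qed.

Lemma card_sets (T : finType) : #|{: {set T}}| = (2 ^ #|T|)%N.
Proof. by rewrite -[LHS]cardsT -powersetT card_powerset cardsT. Qed.

Lemma same_image_perm (T : finType) p (f r : 'I_p -> T) :
  injective f -> injective r -> f @: setT = r @: setT ->
  exists s : 'S_p, forall i, r i = f (s i).
Proof.
move=> inj_f inj_r im_eq.
have ri i : {j | r i = f j}.
  have /imsetP/sig2_eqW[j _ e] : r i \in f @: setT by rewrite im_eq imset_f.
  by exists j.
have inj_s : injective (fun i => sval (ri i)).
  move=> i i' /(congr1 f); rewrite -(svalP (ri i)) -(svalP (ri i')); exact: inj_r.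
by exists (perm inj_s) => i; rewrite permE -(svalP (ri i)).
Qed.

(** [minor_mx] reads its columns by [nth] with a default that varies with the row. All indices are
    in range, so one injective enumeration [e] of [S] serves every row. *)
Lemma nth_enum_cover (T : finType) (S : {set T}) p (x0 : 'I_p -> T) : #|S| = p ->
  let e j := nth (x0 j) (enum S) j in
  [/\ injective e, e @: setT = S & forall i j : 'I_p, nth (x0 i) (enum S) j = e j].
Proof.
move=> card_S e.
have ltS (j : 'I_p) : (j < size (enum S))%N by rewrite -cardE card_S.
have inj_e : injective e.
  move=> j j' /eqP; rewrite /e (set_nth_default (x0 j')) //.
  by rewrite nth_uniq ?enum_uniq // => /eqP/val_inj.
split=> // [|i j]; last exact: set_nth_default.
apply/eqP; rewrite eqEcard card_imset // cardsT card_ord card_S leqnn andbT.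
by apply/subsetP => _ /imsetP[j _ ->]; rewrite -mem_enum mem_nth.
Qed.

(** List [T1] as the image of [h] followed by the rest, [T2] likewise for [g], and match equal
    positions. Used to complete rows and labels that are prescribed only in part. *)
Lemma extend_injection (K T1 T2 : finType) (h : K -> T1) (g : K -> T2) :
  injective h -> injective g -> (#|T1| <= #|T2|)%N ->
  exists2 phi : T1 -> T2, injective phi & forall k, phi (h k) = g k.
Proof.
move=> inj_h inj_g leT.
pose full (T : finType) (f : K -> T) := codom f ++ enum [predC codom f].
have uniq_full (T : finType) (f : K -> T) : injective f -> uniq (full T f).
  move=> inj_f; rewrite cat_uniq map_inj_uniq // !enum_uniq andbT /=; apply/hasPn => x.
  by rewrite mem_enum.
have mem_full (T : finType) (f : K -> T) x : x \in full T f.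
  by rewrite mem_cat mem_enum inE orbN.
have size_full (T : finType) (f : K -> T) : injective f -> size (full T f) = #|T|.
  move=> inj_f; rewrite -(card_uniqP (uniq_full _ _ inj_f)).
  by apply: eq_card => x; rewrite mem_full.
case: (pickP T2) => [z _|T20]; last first.
  have T10 : #|T1| = 0%N by apply/eqP; rewrite -leqn0 (leq_trans leT) // (eq_card0 T20).
  have T1F (x : T1) : False by have := card0_eq T10 x.
  by exists (fun x => False_rect _ (T1F x)) => [x|k]; [case: (T1F x)|case: (T1F (h k))].
exists (fun x => nth z (full T2 g) (index x (full T1 h))) => [x y /eqP|k].
  have lt_index w : (index w (full T1 h) < size (full T2 g))%N.
    by rewrite size_full // (leq_trans _ leT) // -(size_full T1 h) // index_mem.
  rewrite nth_uniq ?uniq_full // => /eqP eq_index.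
  by rewrite -(nth_index x (mem_full T1 h x)) eq_index nth_index.
rewrite index_cat codom_f nth_cat.
have -> : index (h k) (codom h) = enum_rank k.
  rewrite -[k in h k]enum_rankK -(nth_codom (h k) h (enum_rank k)).
  by rewrite index_uniq ?size_codom ?ltn_ord //; apply/injectiveP.
rewrite size_codom ltn_ord -[k in RHS]enum_rankK.
exact: nth_codom.
Qed.

Lemma big_enum_seq (A : Type) (idx : A) (op : Monoid.law idx) (T : finType)
    (S : {pred T}) (F : T -> A) :
  \big[op/idx]_(x <- enum S) F x = \big[op/idx]_(x in S) F x.
Proof. by rewrite -[RHS]big_filter deprecated_filter_index_enum. Qed.

(** [op] is any monoid law: the increasing order of the factors is kept, as products of matrices
    require. *)
Lemma prod_enum_nth (A : Type) (idx : A) (op : Monoid.law idx) (I : finType)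
    (S : {set I}) p (x0 : 'I_p -> I) (F : I -> A) : #|S| = p ->
  \big[op/idx]_(i < p) F (nth (x0 i) (enum S) i) = \big[op/idx]_(x in S) F x.
Proof.
move=> card_S; subst p; rewrite -big_enum_seq.
have [z _|S0] := pickP (mem S); last first.
  rewrite (eq_enum S0) enum0 big_nil big1 // => i _.
  by have := ltn_ord i; rewrite [X in (_ < X)%N](eq_card0 S0).
rewrite (big_nth z) big_mkord -cardE; apply: eq_bigr => i _.
by congr (F _); apply: set_nth_default; rewrite -cardE.
Qed.

Section SetFlip.

Variables (C : numDomainType) (T : finType).
Implicit Types X Y : {set T}.

(** Toggling the membership of [b] permutes the sets, so the sum equals its own negative. *)
Lemma sum_odd_flip (b : T) (F : {set T} -> C) :
  (forall X : {set T}, F [set x | (x == b) (+) (x \in X)] = - F X) -> \sum_X F X = 0.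
Proof.
pose flip (X : {set T}) := [set x | (x == b) (+) (x \in X)] => oddF.
have inj_flip : injective flip.
  move=> X Y /setP eq_flip; apply/setP => x.
  by have := eq_flip x; rewrite !inE => /addbI.
apply/eqP; rewrite -eqNr [X in _ == X](reindex_inj inj_flip) -sumrN; apply/eqP.
by apply: eq_bigr => X _; rewrite oddF.
Qed.

(** Sylvester-Hadamard matrix, with subsets in place of bit vectors. *)
Definition hadamard (X Y : {set T}) : C := (-1) ^+ #|X :&: Y|.

Lemma hadamard_sqr X Y : hadamard X Y * hadamard X Y = 1.
Proof. by rewrite -expr2 sqrr_sign. Qed.

Lemma normr_hadamard X Y : `|hadamard X Y| = 1.
Proof. by rewrite normrX normrN1 expr1n. Qed.

Lemma hadamard_prod X Y : hadamard X Y = \prod_(b in X) (-1) ^+ (b \in Y).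
Proof.
rewrite prodrXr /hadamard; congr (_ ^+ _).
rewrite -sum1_card [RHS]big_mkcond /= [LHS]big_mkcond /=.
by apply: eq_bigr => b _; rewrite inE; case: (b \in X); case: (b \in Y).
Qed.

Lemma hadamard_flip b X Y :
  hadamard X [set x | (x == b) (+) (x \in Y)] = (-1) ^+ (b \in X) * hadamard X Y.
Proof.
rewrite !hadamard_prod; have [bX|bX] := boolP (b \in X).
  rewrite (bigD1 b) //= [in RHS](bigD1 b) //= inE eqxx mulrA; congr (_ * _).
    by case: (b \in Y); rewrite /= ?mulrNN mulr1.
  by apply: eq_bigr => x /andP[_ /negPf neq]; rewrite inE neq.
rewrite mul1r; apply: eq_bigr => x xX; rewrite inE; case: eqP => // xb.
by rewrite xb (negPf bX) in xX.
Qed.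

(** If some [b] lies in exactly one of [X] and [X'], toggling [b] in [Y] negates the summand. *)
Lemma hadamard_orth X X' :
  \sum_(Y : {set T}) hadamard X Y * hadamard X' Y = (2 ^ #|T| * (X == X'))%:R.
Proof.
have [->|neq] := eqVneq X X'.
  under eq_bigr do rewrite hadamard_sqr.
  by rewrite sumr_const card_sets muln1.
have [b] : exists b, (b \in X) != (b \in X').
  apply/existsP; apply: contraR neq => /existsPn eqX; apply/eqP/setP => b.
  by apply/eqP; have := eqX b; rewrite negbK.
rewrite muln0 => bX; apply: (@sum_odd_flip b) => Y; rewrite !hadamard_flip mulrACA.
by case: (b \in X) bX; case: (b \in X') => //= _; rewrite ?mulr1 ?mul1r mulN1r.
Qed.

End SetFlip.

Section Twirl.

Variables (C : numDomainType) (T : finType).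

Definition flip_sign (X : {set T}) (b : T) : C := (-1) ^+ (b \in X).

(** If [f] maps onto [S], it is injective by cardinality and every sign occurs squared. Otherwise
    [f] misses some [b] in [S], and toggling [b] negates only the product over [S]. *)
Lemma sum_flip_sign (S : {set T}) p (f : 'I_p -> T) : #|S| = p ->
  \sum_(X : {set T}) (\prod_(b in S) flip_sign X b) * \prod_i flip_sign X (f i)
  = if f @: setT == S then (2 ^ #|T|)%:R else 0.
Proof.
move=> card_S; case: eqP => [SE|neq_S].
  have inj_f : injective f by apply: imset_full_inj; rewrite SE.
  rewrite -card_sets -sumr_const; apply: eq_bigr => X _.
  rewrite -SE big_imset /=; last by move=> ? ? _ _; apply: inj_f.
  rewrite big_mkcond /= -big_split /= big1 // => i _.
  by rewrite inE -exprD addnn -signr_odd odd_double expr0.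
have [b bS bNf] : exists2 b, b \in S & b \notin f @: setT.
  apply/subsetPn/negP => sub_S; case: neq_S; apply/esym/eqP.
  by rewrite eqEcard sub_S card_S (leq_trans (leq_imset_card _ _)) // cardsT card_ord.
apply: (@sum_odd_flip _ _ b) => X.
rewrite (bigD1 b) // [in RHS](bigD1 b) //= /flip_sign inE eqxx.
rewrite -!mulNr; congr (_ * _ * _).
- by case: (b \in X); rewrite /= ?opprK.
- by apply: eq_bigr => x /andP[_ /negPf neq_x]; rewrite inE neq_x.
- apply: eq_bigr => i _; rewrite inE (negPf (_ : f i != b)) //.
  by apply: contraNneq bNf => <-; apply: imset_f.
Qed.

End Twirl.

(** * Pairs of consecutive indices *)

Section Doubling.

Lemma dbl_subproof n (j : 'I_n) (b : bool) : (b + j.*2 < 2 * n)%N.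
Proof. by case: j b => j /= ltj [] /=; lia. Qed.

Definition dbl n (j : 'I_n) (b : bool) : 'I_(2 * n) := Ordinal (dbl_subproof j b).

Lemma dbl_half n (j : 'I_n) b : (dbl j b)./2 = j.
Proof. by rewrite /= half_bit_double. Qed.

Lemma dbl_odd n (j : 'I_n) b : odd (dbl j b) = b.
Proof. by rewrite /= oddD odd_double addbF; case: b. Qed.

Lemma dbl_inj n (j j' : 'I_n) b b' : dbl j b = dbl j' b' -> j = j' /\ b = b'.
Proof.
move=> e; split; last by rewrite -(dbl_odd j b) e dbl_odd.
by apply: val_inj; rewrite /= -(dbl_half j b) e dbl_half.
Qed.

Lemma dbl_inE n (j : 'I_n) (i : 'I_(2 * n)) : i./2 = j -> i = dbl j (odd i).
Proof. by move=> e; apply: val_inj; rewrite /= -e odd_double_half. Qed.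

Lemma big_dbl (A : Type) (idx : A) (op : Monoid.law idx) n (F : 'I_(2 * n) -> A) :
  \big[op/idx]_i F i = \big[op/idx]_(j < n) op (F (dbl j false)) (F (dbl j true)).
Proof.
(* The type of the index changes with [n], so [F] is extended to all naturals before the
   induction. *)
pose G i := if insub i is Some x then F x else idx.
have GE (i : 'I_(2 * n)) : F i = G i by rewrite /G valK.
under eq_bigr do rewrite GE; under [RHS]eq_bigr do rewrite !GE /=.
move: G {GE} => {F} G; elim: n => [|n IH]; first by rewrite !big_ord0.
rewrite mulnS !add2n !big_ord_recr /= -[in RHS]IH -Monoid.mulmA.
by rewrite mul2n.
Qed.

Lemma mem_bigcup_pairset n (J : {set 'I_n}) (j : 'I_n) b :
  (dbl j b \in \bigcup_(i in J) pairset i) = (j \in J).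
Proof.
apply/bigcupP/idP => [[i iJ]|jJ].
  by rewrite inE dbl_half => /eqP/val_inj ->.
by exists j; rewrite // inE dbl_half.
Qed.

Lemma big_pairsets (A : Type) (idx : A) (op : Monoid.law idx) n (J : {set 'I_n})
    (F : 'I_(2 * n) -> A) :
  \big[op/idx]_(i in \bigcup_(j in J) pairset j) F i
  = \big[op/idx]_(j in J) op (F (dbl j false)) (F (dbl j true)).
Proof.
rewrite big_mkcond big_dbl [RHS]big_mkcond; apply: eq_bigr => j _.
by rewrite !mem_bigcup_pairset; case: ifP; rewrite ?Monoid.mulm1.
Qed.

End Doubling.

(** * Products of anticommuting elements *)

Section Anticommuting.

Variable A : pzRingType.

(** Moving [g j] to its place passes [j] factors, each at the cost of a sign. *)
Lemma prod_lift_anticomm m (g : 'I_m.+1 -> A) (j : 'I_m.+1) :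
  (forall i i', i != i' -> g i * g i' = - (g i' * g i)) ->
  g j * \prod_(i < m) g (lift j i) = (-1) ^+ j * \prod_(i < m.+1) g i.
Proof.
elim: m g j => [|m IH] g j anti.
  by rewrite big_ord0 [in RHS]big_ord_recl big_ord0 !mulr1 (ord1 j) expr0 mul1r.
have [j'|] := unliftP ord0 j => [->|->]; last by rewrite [in RHS]big_ord_recl expr0 mul1r.
rewrite big_ord_recl [in RHS]big_ord_recl mulrA.
have ->: lift (lift ord0 j') ord0 = ord0 by apply: val_inj.
rewrite anti ?mulNr -?mulrA; last by rewrite eq_sym neq_lift.
have -> : \prod_(i < m) g (lift (lift ord0 j') (lift ord0 i))
        = \prod_(i < m) g (lift ord0 (lift j' i)).
  by apply: eq_bigr => i _; congr (g _); apply: val_inj; rewrite /= /bump; lia.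
rewrite (IH (g \o lift ord0)) => [|i i' neq] /=; last first.
  by apply: anti; rewrite (inj_eq lift_inj).
rewrite /bump leq0n add1n exprS mulN1r mulNr; congr (- _).
by rewrite !mulrA -(commr_sign (g ord0)).
Qed.

Lemma lift_permP m (s : 'S_m.+1) :
  exists s' : 'S_m, s = lift_perm ord0 (s ord0) s'.
Proof.
have lift_s i : {j | s (lift ord0 i) = lift (s ord0) j}.
  case: (unliftP (s ord0) (s (lift ord0 i))) => [j sj|/perm_inj e]; first by exists j.
  by have := neq_lift ord0 i; rewrite e eqxx.
have inj_s' : injective (fun i => sval (lift_s i)).
  move=> i i' /(congr1 (lift (s ord0))).
  by rewrite -(svalP (lift_s i)) -(svalP (lift_s i')) => /perm_inj /lift_inj.
exists (perm inj_s'); apply/permP => i.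
have [i'|] := unliftP ord0 i => ->; last by rewrite lift_perm_id.
by rewrite lift_perm_lift permE; exact: (svalP (lift_s i')).
Qed.

(** The first factor moves to its place with sign [(-1) ^+ s ord0], induction reorders the others by
    [s'], and the two signs multiply to that of [s]. *)
Lemma prod_perm_anticomm m (g : 'I_m -> A) (s : 'S_m) :
  (forall i j, i != j -> g i * g j = - (g j * g i)) ->
  \prod_(i < m) g (s i) = (-1) ^+ s * \prod_(i < m) g i.
Proof.
elim: m g s => [|m IH] g s anti.
  have -> : s = 1%g by apply/permP => -[] //.
  by rewrite !big_ord0 odd_perm1 mulr1.
have [s' sE] := lift_permP s; rewrite big_ord_recl.
rewrite (eq_bigr (fun i => g (lift (s ord0) (s' i)))) => [|i _]; last first.
  by rewrite {1}sE lift_perm_lift.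
rewrite (IH (g \o lift (s ord0))) => [|i i' neq] /=; last first.
  by apply: anti; rewrite (inj_eq lift_inj).
rewrite mulrA (commr_sign (g _)) -mulrA prod_lift_anticomm // mulrA.
by congr (_ * _); rewrite [in RHS]sE odd_lift_perm addFb signr_addb signr_odd -commr_sign.
Qed.

Lemma sqr_anticomm_pair (a b : A) :
  b * a = - (a * b) -> a * a = 1 -> b * b = 1 -> a * b * (a * b) = -1.
Proof. by move=> ba aa bb; rewrite mulrA -(mulrA a) ba mulrN mulrA aa mul1r mulNr bb. Qed.

(** Exchanging the pairs takes four transpositions, so the signs cancel. *)
Lemma anticomm_pairs_comm (a b c d : A) :
  a * c = - (c * a) -> a * d = - (d * a) -> b * c = - (c * b) -> b * d = - (d * b) ->
  a * b * (c * d) = c * d * (a * b).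
Proof.
move=> ac ad bc bd.
rewrite -!mulrA (mulrA b) bc !(mulNr, mulrN) -!mulrA bd !mulrN opprK.
by rewrite (mulrA a) ac !(mulNr, mulrN) -!mulrA (mulrA a) ad !(mulNr, mulrN) opprK -!mulrA.
Qed.

End Anticommuting.

Section MatrixRing.

Variables (F : comNzRingType) (d : nat).
Implicit Types A B : 'M[F]_d.

Lemma mxscaleAl (a : F) A B : (a *: A) * B = a *: (A * B).
Proof. exact/esym/scalemxAl. Qed.

Lemma mxscaleAr (a : F) A B : A * (a *: B) = a *: (A * B).
Proof. exact/esym/scalemxAr. Qed.

Lemma mxscale_prod (I : Type) (r : seq I) (P : pred I) (c : I -> F) (G : I -> 'M[F]_d) :
  \prod_(i <- r | P i) (c i *: G i)
  = \prod_(i <- r | P i) c i *: \prod_(i <- r | P i) G i.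
Proof.
elim/big_rec3: _ => [|i x y z _ ->]; first by rewrite scale1r.
by rewrite mxscaleAl mxscaleAr scalerA.
Qed.

(** The maps [f] with the image of [e] are the [e \o s]; reordering the product of the [g] gives the
    sign of [s], and the Leibniz formula appears. *)
Lemma sum_onto_anticomm (T : finType) p (e : 'I_p -> T) (a : 'I_p -> T -> F)
    (g : T -> 'M[F]_d) :
  injective e ->
  (forall x y, x != y -> g x * g y = - (g y * g x)) ->
  \sum_(f : {ffun 'I_p -> T} | f @: setT == e @: setT)
     \prod_i a i (f i) *: \prod_i g (f i)
  = \det (\matrix_(i, j) a i (e j)) *: \prod_i g (e i).
Proof.
move=> inj_e anti.
pose h (s : 'S_p) : {ffun 'I_p -> T} := [ffun i => e (s i)].
have inj_h : injective h.
  move=> s s' /ffunP eq_h; apply/permP => i.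
  by have := eq_h i; rewrite !ffunE => /inj_e.
have h_im : [set f : {ffun 'I_p -> T} | f @: setT == e @: setT] = h @: setT.
  apply/setP => f; rewrite inE; apply/eqP/imsetP => [fE|[s _ ->]].
    have inj_f : injective f.
      by apply: imset_full_inj; rewrite fE card_imset ?cardsT ?card_ord.
    have [s sE] := same_image_perm inj_e inj_f (esym fE).
    by exists s => //; apply/ffunP => i; rewrite ffunE sE.
  apply/setP => x; apply/imsetP/imsetP => -[i _ ->].
    by exists (s i); rewrite ?ffunE.
  by exists (s^-1%g i); rewrite ?ffunE ?permKV.
rewrite -big_set h_im big_imset /=; last by move=> ? ? _ _; apply: inj_h.
rewrite scaler_suml; apply: eq_big => [s|s _]; first by rewrite inE.
under [X in X *: _]eq_bigr do rewrite ffunE.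
under [X in _ *: X]eq_bigr do rewrite ffunE.
rewrite (@prod_perm_anticomm _ _ (g \o e)) => [|i j neq] /=; last first.
  by apply: anti; rewrite (inj_eq inj_e).
under [in RHS]eq_bigr do rewrite mxE.
by case: (odd_perm s); rewrite ?expr0 ?mul1r // !expr1 !mulN1r scaleNr scalerN.
Qed.

Lemma mxscale_comm (a : F) A B : GRing.comm A B -> GRing.comm A (a *: B).
Proof. by rewrite /GRing.comm mxscaleAl mxscaleAr => ->. Qed.

End MatrixRing.

Section Involution.

Variables (F : numFieldType) (d : nat).
Implicit Types (G : 'M[F]_d) (s : F).

Lemma involution_proj_idem s G : s * s = 1 -> G * G = 1 ->
  let P := 2^-1 *: (1 + s *: G) in P * P = P.
Proof.
move=> ss GG /=; rewrite mxscaleAl mxscaleAr; congr (_ *: _).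
rewrite mulrDl mul1r mulrDr mulr1 mxscaleAl mxscaleAr scalerA ss scale1r GG.
rewrite (addrC _ 1) -mulr2n -scaler_nat scalerA.
by rewrite mulVf ?pnatr_eq0 // scale1r.
Qed.

Lemma involution_proj_comm s s' G G' : G * G' = G' * G ->
  let P := 2^-1 *: (1 + s *: G) in let P' := 2^-1 *: (1 + s' *: G') in P * P' = P' * P.
Proof.
move=> GG' /=; apply: mxscale_comm; apply: commr_sym; apply: mxscale_comm.
apply: commr_sym; apply: commrD; first exact: commr1.
apply: mxscale_comm; apply: commr_sym; apply: commrD; first exact: commr1.
by apply: mxscale_comm; apply: commr_sym.
Qed.

Lemma involution_proj_sum G : 2^-1 *: (1 + G) + 2^-1 *: (1 + -1 *: G) = 1.
Proof.
rewrite -scalerDr addrACA scaleN1r addrN addr0.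
have -> : 1 + 1 = 2 *: (1 : 'M[F]_d) by rewrite scaler_nat mulr2n.
by rewrite scalerA mulVf ?pnatr_eq0 // scale1r.
Qed.

Lemma involution_proj_diff G : 2^-1 *: (1 + G) - 2^-1 *: (1 + -1 *: G) = G.
Proof.
rewrite -scalerBr opprD addrACA addrN add0r scaleN1r opprK.
have -> : G + G = 2 *: G by rewrite scaler_nat mulr2n.
by rewrite scalerA mulVf ?pnatr_eq0 // scale1r.
Qed.

End Involution.

(** * Rotated Majorana operators and the parent measurement *)

Section Adjoint.

Variable R : realType.
Local Notation C := R[i].

Lemma conj_real (x : R) : Num.conj (x%:C%C : C) = x%:C%C.
Proof. by apply: conj_Creal; apply/complex_realP; exists x. Qed.

Lemma adjmxD m p (A B : 'M[C]_(m, p)) : adjmx (A + B) = adjmx A + adjmx B.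
Proof. by rewrite /adjmx map_mxD linearD. Qed.

Lemma adjmxZ m p (a : C) (A : 'M[C]_(m, p)) : adjmx (a *: A) = Num.conj a *: adjmx A.
Proof. by rewrite /adjmx map_mxZ linearZ. Qed.

Lemma adjmx0 m p : adjmx (0 : 'M[C]_(m, p)) = 0.
Proof. by rewrite /adjmx map_mx0 trmx0. Qed.

Lemma adjmx1 d : adjmx (1%:M : 'M[C]_d) = 1%:M.
Proof. by rewrite /adjmx map_mx1 trmx1. Qed.

Lemma adjmx_mul m p r (A : 'M[C]_(m, p)) (B : 'M[C]_(p, r)) :
  adjmx (A *m B) = adjmx B *m adjmx A.
Proof. by rewrite /adjmx map_mxM trmx_mul. Qed.

Lemma adjmx_sum m p (I : Type) (r : seq I) (P : pred I) (F : I -> 'M[C]_(m, p)) :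
  adjmx (\sum_(i <- r | P i) F i) = \sum_(i <- r | P i) adjmx (F i).
Proof. exact: (big_morph _ (@adjmxD m p) (adjmx0 m p)). Qed.

(** The form at [v] is the squared norm of [P v]. *)
Lemma psd_projection d (P : 'M[C]_d) : herm_mx P -> P *m P = P -> psd_mx P.
Proof.
move=> hP PP; split=> // v.
rewrite -PP -{1}hP mulmxA -adjmx_mul -mulmxA mxE sumr_ge0 // => i _.
by rewrite !mxE mulrC mul_conjC_ge0.
Qed.

Lemma psd_scale d (a : C) (P : 'M[C]_d) : 0 <= a -> psd_mx P -> psd_mx (a *: P).
Proof.
move=> a0 [hP psdP]; split.
  by rewrite /herm_mx adjmxZ hP; congr (_ *: _); apply: conj_Creal; apply: ger0_real.
by move=> v; rewrite -scalemxAr -scalemxAl mxE mulr_ge0.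
Qed.

Lemma projection_prod d (I : Type) (r : seq I) (P : I -> 'M[C]_d) :
  (forall i, herm_mx (P i)) -> (forall i, P i * P i = P i) ->
  (forall i j, P i * P j = P j * P i) ->
  let Q := \prod_(i <- r) P i in herm_mx Q /\ Q * Q = Q.
Proof.
move=> hP PP comP; elim: r => [|i r [IHh IHp]] /=.
  by rewrite big_nil mulr1; split=> //; exact: adjmx1.
have comQ : P i * \prod_(j <- r) P j = \prod_(j <- r) P j * P i.
  by apply: commr_prod => j _; apply: comP.
rewrite big_cons; split; first by rewrite /herm_mx adjmx_mul IHh hP; exact/esym/comQ.
by rewrite {2}comQ mulrA -(mulrA (P i)) IHp -mulrA -comQ mulrA PP.
Qed.

End Adjoint.

Section Majorana.

Variables (R : realType) (n : nat) (gamma : 'I_(2 * n) -> 'M[R[i]]_(2 ^ n)).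
Hypothesis maj : majorana gamma.

Lemma majorana_anticomm x y : x != y -> gamma x * gamma y = - (gamma y * gamma x).
Proof.
move=> neq; apply/eqP; rewrite -addr_eq0; apply/eqP.
by have [_ /(_ x y)] := maj; rewrite (negPf neq) muln0 raddf0.
Qed.

Lemma majorana_sq x : gamma x * gamma x = 1.
Proof.
have [_ /(_ x x)] := maj; rewrite eqxx muln1 => /(congr1 (fun M => 2^-1 *: M)).
have -> : gamma x *m gamma x + gamma x *m gamma x = 2 *: (gamma x *m gamma x).
  by rewrite scaler_nat mulr2n.
by rewrite scalerA scale_scalar_mx mulVf ?pnatr_eq0 // scale1r.
Qed.

End Majorana.

Section Rotation.

Variables (R : realType) (n : nat).
Local Notation C := R[i].
Local Notation T := 'I_(2 * n).
Variables (gamma : T -> 'M[C]_(2 ^ n)) (O : 'M[R]_(2 * n)).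
Hypotheses (maj : majorana gamma) (orthO : orth_mx O).
Local Notation t := (flip_sign C).

Lemma xS_even (X S : {set T}) : ~~ odd #|S| -> xS R X S = \prod_(b in S) t X b.
Proof.
move=> evS; rewrite -hadamard_prod /xS -signr_odd oddB; last first.
  (* Subtraction is truncated, so its parity needs [#|S :&: X| <= #|X| * #|S|], clear for empty [S]
     and otherwise from [0 < #|S|]. *)
  have [->|/set0Pn[b bS]] := eqVneq S set0; first by rewrite set0I cards0.
  rewrite (leq_trans (subset_leq_card (subsetIr S X))) // leq_pmulr //.
  by apply/card_gt0P; exists b.
by rewrite oddM (negPf evS) andbF signr_odd.
Qed.

Definition rot_majorana (X : {set T}) (i : T) : 'M[C]_(2 ^ n) :=
  \sum_b ((O i b)%:C%C * t X b) *: gamma b.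

(** In the double sum of anticommutators only the diagonal survives; there the signs square to 1 and
    the rows of [O] are orthonormal. *)
Lemma rot_majoranaP X : majorana (rot_majorana X).
Proof.
case: maj => hg cg; split=> [i|i j].
  rewrite /herm_mx adjmx_sum; apply: eq_bigr => b _.
  by rewrite adjmxZ hg rmorphM /= conj_real rmorph_sign.
rewrite !mulmx_suml -big_split /=.
have -> : \sum_b (((O i b)%:C%C * t X b) *: gamma b *m rot_majorana X j
     + ((O j b)%:C%C * t X b) *: gamma b *m rot_majorana X i)
  = \sum_b \sum_c (((O i b)%:C%C * t X b) * ((O j c)%:C%C * t X c))
        *: (gamma b *m gamma c + gamma c *m gamma b).
  under [RHS]eq_bigr do under eq_bigr do rewrite scalerDr.
  under [RHS]eq_bigr do rewrite big_split /=.
  rewrite !big_split /=; congr (_ + _); last rewrite exchange_big /=.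
    apply: eq_bigr => b _; rewrite mulmx_sumr; apply: eq_bigr => c _.
    by rewrite -scalemxAl -scalemxAr scalerA.
  apply: eq_bigr => b _; rewrite mulmx_sumr; apply: eq_bigr => c _.
  by rewrite -scalemxAl -scalemxAr scalerA mulrC.
under eq_bigr do under eq_bigr do rewrite cg scale_scalar_mx.
have sum_row b : \sum_c ((O i b)%:C%C * t X b * ((O j c)%:C%C * t X c)
     * (2 * (b == c))%:R)%:M = (2 * (O i b * O j b)%:C%C)%:M :> 'M[C]_(2 ^ n).
  rewrite (bigD1 b) //= big1 ?addr0 => [|c /negPf neq]; last first.
    by rewrite eq_sym neq muln0 mulr0 raddf0.
  rewrite eqxx muln1 mulrACA -rmorphM -expr2 /flip_sign sqrr_sign.
  by rewrite mulr1 mulrC.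
under eq_bigr do rewrite sum_row.
rewrite -raddf_sum /= -mulr_sumr -rmorph_sum /=; congr (_%:M).
have -> : \sum_b O i b * O j b = (i == j)%:R.
  have /matrixP/(_ i j) := orthO; rewrite !mxE => <-.
  by apply: eq_bigr => b _; rewrite mxE.
by rewrite natrM rmorph_nat.
Qed.

Lemma sum_onto_minor (Rs S : {set T}) : #|S| = #|Rs| ->
  \sum_(f : {ffun 'I_#|Rs| -> T} | f @: setT == S)
     \prod_i (O (enum_val i) (f i))%:C%C *: \prod_i gamma (f i)
  = (minor_mx O Rs S)%:C%C *: \prod_(x <- enum S) gamma x.
Proof.
move=> card_S.
pose e (j : 'I_#|Rs|) := nth (enum_val j) (enum S) j.
have [inj_e eS nthE] := nth_enum_cover (@enum_val _ (mem Rs)) card_S.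
rewrite -{1}eS (sum_onto_anticomm (fun i x => (O (enum_val i) x)%:C%C) inj_e (majorana_anticomm maj)).
rewrite big_enum_seq -(prod_enum_nth _ (@enum_val _ (mem Rs)) _ card_S); congr (_ *: _).
rewrite /minor_mx -[RHS]det_map_mx; congr (\det _); apply/matrixP => i j.
by rewrite !mxE nthE.
Qed.

Lemma prod_rot_majorana X p (r : 'I_p -> T) :
  \prod_i rot_majorana X (r i)
  = \sum_(f : {ffun 'I_p -> T}) ((\prod_i (O (r i) (f i))%:C%C) * \prod_i t X (f i))
        *: \prod_i gamma (f i).
Proof.
by rewrite bigA_distr_bigA; apply: eq_bigr => f _; rewrite mxscale_prod -big_split.
Qed.

(* Averaging [x_S] over [X] kills every monomial of the expanded product whose
   index function is not a bijection from [Rs] onto [S]. *)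
Lemma twirl_minor (Rs S : {set T}) : #|S| = #|Rs| -> ~~ odd #|Rs| ->
  \sum_X xS R X S *: \prod_(x in Rs) rot_majorana X x
  = (2 ^ (2 * n))%:R *: ((minor_mx O Rs S)%:C%C *: \prod_(x <- enum S) gamma x).
Proof.
move=> card_S evR; rewrite -sum_onto_minor // [in RHS]big_mkcond scaler_sumr.
have expand X : xS R X S *: \prod_(x in Rs) rot_majorana X x
  = \sum_(f : {ffun 'I_#|Rs| -> T}) ((\prod_i (O (enum_val i) (f i))%:C%C)
      * ((\prod_(b in S) t X b) * \prod_i t X (f i))) *: \prod_i gamma (f i).
  rewrite -(prod_enum_nth _ (@enum_default _ (mem Rs)) _ (erefl _)) prod_rot_majorana.
  rewrite xS_even ?card_S // scaler_sumr.
  by apply: eq_bigr => f _; rewrite scalerA mulrCA.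
under eq_bigr do rewrite expand.
rewrite exchange_big /=; apply: eq_bigr => f _.
rewrite -scaler_suml -mulr_sumr sum_flip_sign // card_ord.
case: ifP => _; last by rewrite mulr0 scale0r scaler0.
by rewrite mulrC -scalerA.
Qed.

(* The repeated indices sum to the scalar product of two distinct rows. *)
Lemma sum_noninjective_rows X p (r : 'I_p -> T) : p = 2 -> injective r ->
  \sum_(f : {ffun 'I_p -> T} | #|f @: setT| != p)
     ((\prod_i (O (r i) (f i))%:C%C) * \prod_i t X (f i)) *: \prod_i gamma (f i) = 0.
Proof.
(* [p] is a variable until here because the lemma is applied at [#|pairset j|]. A map from two
   indices whose image does not have two elements is constant. *)
move=> p2; subst p => inj_r.
pose h (x : T) : {ffun 'I_2 -> T} := [ffun => x].
have inj_h : injective h by move=> x y /ffunP/(_ ord0); rewrite !ffunE.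
have h_im : [set f : {ffun 'I_2 -> T} | #|f @: setT| != 2] = h @: setT.
  apply/setP => f; rewrite inE; apply/idP/imsetP => [|[x _ ->]].
    move=> neq; exists (f ord0) => //; apply/ffunP => i; rewrite ffunE.
    apply/eqP; apply: contraR neq => neq.
    suff -> : f @: setT = [set f i; f ord0] by rewrite cards2 neq.
    apply/setP => x; rewrite !inE; apply/imsetP/orP => [[j _ ->]|[] /eqP ->]; last 2 first.
    - by exists i.
    - by exists ord0.
    have : (j == i) || (j == ord0).
      have : i != ord0 by apply: contraNneq neq => ->.
      by case: i {neq} j => -[|[|?]] // ? [[|[|?]] ?].
    by case/orP => /eqP ->; [left|right].
  suff -> : h x @: setT = [set x] by rewrite cards1.
  apply/setP => y; rewrite inE; apply/imsetP/eqP => [[i _ ->]|->]; first by rewrite ffunE.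
  by exists ord0; rewrite ?ffunE.
rewrite -big_set h_im big_imset /=; last by move=> ? ? _ _; apply: inj_h.
have row_orth : \sum_x O (r ord0) x * O (r (lift ord0 ord0)) x = 0.
  have /matrixP/(_ (r ord0) (r (lift ord0 ord0))) := orthO; rewrite !mxE.
  rewrite (inj_eq inj_r) mulr0n => sumE; apply: etrans sumE.
  by apply: eq_bigr => b _; rewrite mxE.
under eq_bigr => x _.
  rewrite !big_ord_recl !big_ord0 !ffunE !mulr1 /flip_sign -expr2 sqrr_sign mulr1.
  rewrite (majorana_sq maj) -rmorphM.
  over.
rewrite (eq_bigl xpredT) => [|x]; last by rewrite inE.
by rewrite -scaler_suml -rmorph_sum row_orth scale0r.
Qed.

(** Expand the product on the right: the noninjective index functions cancel, and those with image
    [S] sum to the minor times [x_S] and the ordered product over [S]. The factor ['i] is the phase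
    of [gammaS] for two elements. *)
Lemma gammaROX_pairset X (j : 'I_n) :
  gammaROX gamma O X (pairset j)
  = 'i *: (rot_majorana X (dbl j false) * rot_majorana X (dbl j true)).
Proof.
have pairE : pairset j = \bigcup_(i in [set j]) pairset i by rewrite big_set1.
have -> : rot_majorana X (dbl j false) * rot_majorana X (dbl j true)
        = \prod_(x in pairset j) rot_majorana X x.
  by rewrite pairE big_pairsets (big_pred1 j) // => i; rewrite inE.
have card_pair : #|pairset j| = 2.
  rewrite -sum1_card pairE; rewrite (big_pairsets addn).
  by rewrite (big_pred1 j) // => i; rewrite inE.
rewrite -(prod_enum_nth _ (@enum_default _ (mem (pairset j))) _ (erefl _)) prod_rot_majorana.
rewrite (bigID (fun f : {ffun _ -> _} => #|f @: setT| == #|pairset j|)) /=.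
rewrite [X in _ + X]sum_noninjective_rows //; last exact: enum_val_inj.
rewrite addr0 /gammaROX.
rewrite (partition_big (fun f : {ffun _ -> _} => f @: setT) (fun S => #|S| == #|pairset j|)) //=.
rewrite scaler_sumr; apply: eq_bigr => S /eqP card_S.
have -> : gammaS gamma S = 'i *: \prod_(x <- enum S) gamma x.
  by rewrite /gammaS card_S card_pair.
rewrite scalerA [_ * 'i]mulrC -scalerA; congr (_ *: _).
rewrite -scalerA -sum_onto_minor // scaler_sumr.
apply: eq_big => [f|f /eqP fS].
  by case: eqP => [->|_]; rewrite ?andbF // card_S eqxx.
rewrite scalerA mulrC xS_even ?card_S ?card_pair // -fS big_imset /=.
  congr ((_ * _) *: _); by apply: eq_bigl => i; rewrite inE.
by move=> i i' _ _; apply: imset_full_inj; rewrite fS.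
Qed.

End Rotation.

Section PairObservables.

Variables (R : realType) (n : nat) (g : 'I_(2 * n) -> 'M[R[i]]_(2 ^ n)).
Hypothesis maj : majorana g.
Local Notation C := R[i].

(** For [g] a rotated family this is the operator [gammaROX] of a pair; the factor ['i] makes it
    Hermitian. *)
Definition pair_op (j : 'I_n) : 'M[C]_(2 ^ n) := 'i *: (g (dbl j false) * g (dbl j true)).

Let dbl_neq (j : 'I_n) : dbl j false != dbl j true.
Proof. by apply/eqP => /dbl_inj[]. Qed.

Lemma pair_op_herm j : herm_mx (pair_op j).
Proof.
have [hg _] := maj.
rewrite /herm_mx adjmxZ conjCi scaleNr adjmx_mul !hg.
by rewrite mulmxE (majorana_anticomm maj) 1?eq_sym // scalerN opprK.
Qed.

Lemma pair_op_sq j : pair_op j * pair_op j = 1.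
Proof.
rewrite mxscaleAl mxscaleAr scalerA -expr2 sqrCi scaleN1r.
rewrite sqr_anticomm_pair ?(majorana_sq maj) ?opprK //.
by apply: (majorana_anticomm maj); rewrite eq_sym.
Qed.

Lemma pair_op_comm i j : pair_op i * pair_op j = pair_op j * pair_op i.
Proof.
have [->//|neq] := eqVneq i j.
have anti b c : g (dbl i b) * g (dbl j c) = - (g (dbl j c) * g (dbl i b)).
  by apply: (majorana_anticomm maj); apply: contraNneq neq => /dbl_inj[->].
rewrite !mxscaleAl !mxscaleAr; congr (_ *: (_ *: _)).
exact: anticomm_pairs_comm.
Qed.

Definition pair_proj (j : 'I_n) (b : bool) : 'M[C]_(2 ^ n) :=
  2^-1 *: (1 + sgnb R b *: pair_op j).

Lemma pair_proj_herm j b : herm_mx (pair_proj j b).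
Proof.
rewrite /herm_mx adjmxZ adjmxD adjmx1 adjmxZ pair_op_herm.
congr (_ *: (_ + _ *: _)); first by rewrite fmorphV rmorph_nat.
by case: b; rewrite /= ?rmorphN rmorph1.
Qed.

Lemma pair_proj_comm i j b c : pair_proj i b * pair_proj j c = pair_proj j c * pair_proj i b.
Proof. exact/involution_proj_comm/pair_op_comm. Qed.

Lemma pair_proj_idem j b : pair_proj j b * pair_proj j b = pair_proj j b.
Proof.
apply: involution_proj_idem; last exact: pair_op_sq.
by case: b; rewrite /= ?mulrNN mulr1.
Qed.

Lemma sum_pair_proj j : \sum_b pair_proj j b = 1.
Proof. by rewrite big_bool /pair_proj scale1r; apply: involution_proj_sum. Qed.

Lemma sum_sgn_pair_proj j : \sum_b sgnb R b *: pair_proj j b = pair_op j.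
Proof.
rewrite big_bool; set P := pair_proj j true; set P' := pair_proj j false.
rewrite /= scale1r scaleN1r /P /P' /pair_proj /= scale1r; exact: involution_proj_diff.
Qed.

Lemma prod_pair_op (J : {set 'I_n}) :
  \prod_(j in J) pair_op j
  = 'i ^+ #|J| *: \prod_(x in \bigcup_(j in J) pairset j) g x.
Proof. by rewrite big_pairsets mxscale_prod prodr_const. Qed.

End PairObservables.

Lemma card_pairsets n (J : {set 'I_n}) : #|\bigcup_(j in J) pairset j| = (2 * #|J|)%N.
Proof. by rewrite -sum1_card (big_pairsets addn) sum_nat_const mulnC. Qed.

(** * The parent POVM and its post-processing *)

Section JointMeasurement.

Variables (R : realType) (n : nat).
Local Notation C := R[i].
Variable gamma : 'I_(2 * n) -> 'M[C]_(2 ^ n).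
Hypotheses (maj : majorana gamma) (n_gt0 : (0 < n)%N).

(** Each of the [n] factors is a projection over [2 ^ (2 * n)], and the prefactor of [GO] cancels
    all but one of these denominators, as [n] is positive. *)
Lemma GO_proj (O : 'M[R]_(2 * n)) q X : orth_mx O ->
  GO gamma O q X
  = ((2 ^ (2 * n))%:R)^-1 *: \prod_j pair_proj (rot_majorana gamma O X) j (q j).
Proof.
move=> orthO; rewrite /GO.
have GRE j : GR gamma O (pairset j) (q j) X
    = ((2 ^ (2 * n))%:R)^-1 *: pair_proj (rot_majorana gamma O X) j (q j).
  rewrite /GR /pair_proj gammaROX_pairset // scalerA -invfM -natrM.
  by rewrite -expnSr addn1.
rewrite (eq_bigr _ (fun j _ => GRE j)) mxscale_prod scalerA prodr_const card_ord natrX exprVn; congr (_ *: _).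
case: n n_gt0 => // n' _; rewrite subn1 /= [in X in _ / X]exprS invfM mulrCA divff ?mulr1 //.
by rewrite expf_neq0 // pnatr_eq0 expn_eq0.
Qed.

(** The sum over [q] factorises over the pairs: a pair in [J] contributes its signed sum [pair_op],
    any other pair the identity. *)
Lemma sum_sgn_GO (O : 'M[R]_(2 * n)) X (J : {set 'I_n}) : orth_mx O ->
  \sum_(q : {ffun 'I_n -> bool}) (\prod_(j in J) sgnb R (q j)) *: GO gamma O q X
  = ((2 ^ (2 * n))%:R)^-1 *: ('i ^+ #|J|
      *: \prod_(x in \bigcup_(j in J) pairset j) rot_majorana gamma O X x).
Proof.
move=> orthO; rewrite -prod_pair_op.
pose c j b := if j \in J then sgnb R b else 1.
transitivity (((2 ^ (2 * n))%:R)^-1 *: \sum_(q : {ffun 'I_n -> bool})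
    \prod_j (c j (q j) *: pair_proj (rot_majorana gamma O X) j (q j))).
  rewrite scaler_sumr; apply: eq_bigr => q _.
  rewrite (mxscale_prod _ _ (fun j => c j (q j))) GO_proj // !scalerA mulrC; congr (_ * _ *: _).
  by rewrite big_mkcond.
rewrite -(bigA_distr_bigA (fun j b => c j b *: pair_proj (rot_majorana gamma O X) j b)).
rewrite [in RHS]big_mkcond; congr (_ *: _); apply: eq_bigr => j _.
rewrite /c; case: ifP => _; first exact: sum_sgn_pair_proj.
by under eq_bigr do rewrite scale1r; apply: sum_pair_proj.
Qed.

(** The binomials grow by [4 * k + 1] and ['i] has order 4, so the phase of [gammaS] agrees with one
    factor ['i] per pair. *)
Lemma im_binomial k : 'i ^+ 'C(2 * k, 2) = 'i ^+ k :> C.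
Proof.
elim: k => [|k IH]; first by rewrite muln0.
have -> : 'C(2 * k.+1, 2) = ('C(2 * k, 2) + (4 * k).+1)%N.
  by rewrite mulnS !add2n !binS !bin1 !bin0; lia.
rewrite exprD IH exprS exprM -[4%N]/(2 * 2)%N exprM sqrCi sqrrN !expr1n mulr1.
by rewrite mulrC -exprS.
Qed.

(** Summing over [q] leaves the product of rotated operators, and the twirl over [X] extracts its
    [S] component; the number of sets [X] cancels the normalisation. *)
Lemma sum_xS_sgn_GO (O : 'M[R]_(2 * n)) (J : {set 'I_n}) (S : {set 'I_(2 * n)}) :
  orth_mx O -> #|S| = (2 * #|J|)%N ->
  \sum_X \sum_(q : {ffun 'I_n -> bool}) (xS R X S * \prod_(j in J) sgnb R (q j)) *: GO gamma O q X
  = (minor_mx O (\bigcup_(j in J) pairset j) S)%:C%C *: gammaS gamma S.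
Proof.
move=> orthO card_S.
have sum_q X : \sum_(q : {ffun 'I_n -> bool})
     (xS R X S * \prod_(j in J) sgnb R (q j)) *: GO gamma O q X
  = (((2 ^ (2 * n))%:R)^-1 * 'i ^+ #|J|) *: (xS R X S
       *: \prod_(x in \bigcup_(j in J) pairset j) rot_majorana gamma O X x).
  rewrite (eq_bigr _ (fun q _ => esym (scalerA _ _ _))) -scaler_sumr sum_sgn_GO //.
  by rewrite !scalerA -mulrA mulrC.
rewrite (eq_bigr _ (fun X _ => sum_q X)) -scaler_sumr twirl_minor ?card_pairsets //; last first.
  by rewrite oddM.
rewrite /gammaS !scalerA card_S im_binomial; congr (_ *: _).
have : (2 ^ (2 * n))%:R != 0 :> C by rewrite pnatr_eq0 expn_eq0.
move: (2 ^ (2 * n))%:R => c c0.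
by field.
Qed.

Definition sgnr (b : bool) : R := if b then 1 else -1.

Lemma sgnrC b : (sgnr b)%:C%C = sgnb R b.
Proof. by case: b; rewrite /= ?rmorphN rmorph1. Qed.

Lemma povm_Gpar N (O : 'I_N -> 'M[R]_(2 * n)) :
  (0 < N)%N -> (forall r, orth_mx (O r)) -> povm (Gpar gamma O).
Proof.
move=> N_gt0 orthO; split=> [[[r q] X]|].
  rewrite /Gpar GO_proj //; apply: psd_scale; rewrite ?invr_ge0 ?ler0n //.
  apply: psd_scale; rewrite ?invr_ge0 ?ler0n //.
  have maj' : majorana (rot_majorana gamma (O r) X) by apply: rot_majoranaP.
  pose P j := pair_proj (rot_majorana gamma (O r) X) j (q j).
  have [hP PP] := @projection_prod _ _ _ (index_enum 'I_n) P
     (fun j => pair_proj_herm maj' j _) (fun j => pair_proj_idem maj' j _)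
     (fun i j => pair_proj_comm maj' i j _ _).
  exact: psd_projection.
pose G r q X : 'M[C]_(2 ^ n) := (N%:R)^-1 *: GO gamma (O r) q X.
transitivity (\sum_r \sum_q \sum_X G r q X); first by rewrite !pair_bigA.
under eq_bigr => r _ do rewrite exchange_big /=.
(* Completeness is [sum_sgn_GO] for the empty [J]. *)
have sum_q r X : \sum_q G r q X = ((N%:R)^-1 * ((2 ^ (2 * n))%:R)^-1) *: (1 : 'M[C]_(2 ^ n)).
  rewrite -scaler_sumr -scalerA; congr (_ *: _).
  have := sum_sgn_GO X set0 (orthO r); rewrite cards0 expr0 scale1r.
  rewrite big_set0 big_pred0 => [<-|i]; last by rewrite inE.
  by apply: eq_bigr => q _; rewrite big_set0 scale1r.
rewrite (eq_bigr _ (fun r _ => eq_bigr _ (fun X _ => sum_q r X))).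
set c := _ / _; transitivity ((\sum_(r < N) \sum_(X : {set 'I_(2 * n)}) c) *: (1 : 'M[C]_(2 ^ n))).
  by rewrite scaler_suml; apply: eq_bigr => r _; rewrite scaler_suml.
suff -> : \sum_(r < N) \sum_(X : {set 'I_(2 * n)}) c = 1 by rewrite scale1r.
rewrite {}/c.
rewrite !sumr_const card_sets !card_ord.
have : (2 ^ (2 * n))%:R != 0 :> C by rewrite pnatr_eq0 expn_eq0.
have : N%:R != 0 :> C by rewrite pnatr_eq0 -lt0n.
rewrite -[LHS]mulr_natr -[X in X * _]mulr_natr.
by move: (2 ^ (2 * n))%:R (N%:R) => c d d0 c0; field; rewrite c0.
Qed.

(** Each [S] uses only one matrix with a large minor. If another [r] is drawn, a fair coin is
    reported; otherwise the sign [x_S q_R] biases the coin by [kappa S]. *)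
Lemma joint_measurement N k (O : 'I_N -> 'M[R]_(2 * n)) (eta : R) :
  (0 < N)%N -> (forall r, orth_mx (O r)) -> 0 < eta ->
  (forall S : {set 'I_(2 * n)}, #|S| = (2 * k)%N ->
     exists r Rs, inD k Rs /\ eta * N%:R <= `|minor_mx (O r) Rs S|) ->
  jointly_measures (Gpar gamma O) (fun S : {set 'I_(2 * n)} => #|S| == (2 * k)%N)
    (Munsharp gamma eta).
Proof.
move=> N_gt0 orthO eta_gt0 large.
pose U (J : {set 'I_n}) : {set 'I_(2 * n)} := \bigcup_(j in J) pairset j.
have {large} /fin_all_exists[c cP] : forall S : {set 'I_(2 * n)},
    exists p : 'I_N * {set 'I_n}, #|S| = (2 * k)%N ->
      #|p.2| = k /\ eta * N%:R <= `|minor_mx (O p.1) (U p.2) S|.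
  move=> S; have [/large[r [_ [[J [cardJ ->]] le]]]|neq] := eqVneq #|S| (2 * k)%N.
    by exists (r, J).
  (* An arbitrary value, for sets of another size. *)
  by exists (Ordinal N_gt0, set0) => e; rewrite e eqxx in neq.
pose mn (S : {set 'I_(2 * n)}) := minor_mx (O (c S).1) (U (c S).2) S.
(* The factor [N] makes up for the probability [1 / N] of drawing the right matrix, and dividing by
   the signed minor cancels the one left by the twirl. The lower bound on the minor keeps [kappa S]
   within modulus 1. *)
pose kappa (S : {set 'I_(2 * n)}) := eta * N%:R / mn S.
pose sg (X S : {set 'I_(2 * n)}) : R := (-1) ^+ (#|X| * #|S| - #|S :&: X|).
pose w (S : {set 'I_(2 * n)}) (l : 'I_N * {ffun 'I_n -> bool} * {set 'I_(2 * n)}) : R :=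
  if l.1.1 == (c S).1 then kappa S * (sg l.2 S * \prod_(j in (c S).2) sgnr (l.1.2 j)) else 0.
have mn_gt0 (S : {set 'I_(2 * n)}) : #|S| = (2 * k)%N -> 0 < `|mn S|.
  by move=> /cP[_]; apply: lt_le_trans; rewrite mulr_gt0 ?ltr0n.
have w_le1 (S : {set 'I_(2 * n)}) l : #|S| = (2 * k)%N -> `|w S l| <= 1.
  move=> card_S; rewrite /w; case: ifP => _; last by rewrite normr0.
  rewrite !normrM normrX normrN1 expr1n mul1r normr_prod big1 => [|j _]; last first.
    by case: (l.1.2 j); rewrite /= ?normrN normr1.
  rewrite mulr1 normrV ?unitfE -?normr_gt0 ?mn_gt0 // ler_pdivrMr ?mn_gt0 // mul1r.
  by rewrite gtr0_norm // normr_nat; have [] := cP S card_S.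
exists (fun (S : {set 'I_(2 * n)}) l e => 2^-1 * (1 + sgnr e * w S l)); split=> [S l e /eqP card_S|].
  rewrite mulr_ge0 ?invr_ge0 ?ler0n //.
  have := w_le1 S l card_S; rewrite ler_norml => /andP[].
  by case: e; rewrite /sgnr => *; lra.
split=> [S l _|S e /eqP card_S]; first by rewrite /sgnr; lra.
have [_ sumG] := povm_Gpar N_gt0 orthO.
have sum_w : \sum_l (w S l)%:C%C *: Gpar gamma O l = eta%:C%C *: gammaS gamma S.
  transitivity (\sum_r \sum_q \sum_X (w S (r, q, X))%:C%C *: Gpar gamma O (r, q, X)).
    by rewrite !pair_bigA; apply: eq_bigr => -[[r q] X].
  have w0 r q X : r != (c S).1 -> w S (r, q, X) = 0 by rewrite /w => /negPf ->.
  rewrite (big_only1 (c S).1) => [|//|r neq _]; last first.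
    by rewrite big1 // => q _; rewrite big1 // => X _; rewrite w0 // scale0r.
  have cardJ : #|S| = (2 * #|(c S).2|)%N by have [-> _] := cP S card_S.
  have termE q X : (w S ((c S).1, q, X))%:C%C *: Gpar gamma O ((c S).1, q, X)
     = (kappa S / N%:R)%:C%C *: ((xS R X S * \prod_(j in (c S).2) sgnb R (q j))
          *: GO gamma (O (c S).1) q X).
    rewrite /w eqxx /Gpar; move: (GO _ _ _ _) => M; rewrite !scalerA; congr (_ *: _).
    move: (kappa S) => kS; rewrite !rmorphM fmorphV rmorph_nat rmorphXn rmorphN rmorph1 rmorph_prod /=.
    by rewrite (eq_bigr _ (fun j _ => sgnrC (q j))) mulrAC.
  rewrite exchange_big.
  under eq_bigr do under eq_bigr do rewrite termE.
  under eq_bigr do rewrite -scaler_sumr.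
  rewrite -scaler_sumr (sum_xS_sgn_GO (orthO _) cardJ) scalerA -rmorphM /=.
  congr (_%:C%C *: _); rewrite -/(U _) -/(mn S) /kappa.
  have : mn S != 0 by rewrite -normr_gt0 mn_gt0.
  have : N%:R != 0 :> R by rewrite pnatr_eq0 -lt0n.
  by move: (mn S) (N%:R : R) => a b b0 a0; field; rewrite b0.
move: (Gpar gamma O) sumG sum_w => G sumG sum_w.
transitivity (\sum_l (2^-1 *: G l + (2^-1 * sgnb R e) *: ((w S l)%:C%C *: G l))); last first.
  apply: eq_bigr => l _; move: (w S l) => x; rewrite scalerA -scalerDl; congr (_ *: _).
  rewrite -sgnrC !rmorphM rmorphD !rmorphM fmorphV rmorph_nat rmorph1.
  by rewrite mulrDr mulr1 mulrA.
rewrite big_split -!scaler_sumr sumG sum_w /Munsharp scalerDr.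
by move: (gammaS _ _) => M; rewrite !scalerA mulrA.
Qed.

End JointMeasurement.

(** * Matched rows of block Hadamard matrices *)

Section Labels.

(* For fixed [t] the two rows differ by [{t}], so the product of their Hadamard
   characters at a column [Y] is the sign of [t \in Y]. Taking the cyclic successor
   of [t] makes the rows distinct for distinct [t] (as soon as [2 < m]). *)
Definition within_row m (tb : 'I_m * bool) : {set 'I_m} :=
  if tb.2 then [set tb.1; ordS tb.1] else [set ordS tb.1].

Lemma ordS_neq m (t : 'I_m) : (2 < m)%N -> ordS t != t.
Proof.
move=> m3; apply/eqP => /(congr1 val) /=.
have := ltn_ord t; rewrite leq_eqVlt => /orP[/eqP e|lt]; last by rewrite modn_small //; lia.
by rewrite e modnn; lia.
Qed.

Lemma ordSS_neq m (t : 'I_m) : (2 < m)%N -> ordS (ordS t) != t.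
Proof.
move=> m3; apply/eqP => /(congr1 val) /=.
have := ltn_ord t; rewrite leq_eqVlt => /orP[/eqP e|lt]; first by rewrite e modnn modn_small; lia.
rewrite (modn_small lt); move: lt; rewrite leq_eqVlt => /orP[/eqP e|lt]; first by rewrite e modnn; lia.
by rewrite modn_small; lia.
Qed.

(** The cardinality reveals [b], and [[set t; ordS t]] determines [t] because [ordS (ordS t)]
    differs from [t]. *)
Lemma within_row_inj m : (2 < m)%N -> injective (@within_row m).
Proof.
move=> m3 [t b] [s c]; rewrite /within_row /= => eq_row.
have := congr1 (fun A : {set _} => #|A|) eq_row.
case: b c eq_row => -[] eq_row; rewrite ?cards1 ?cards2 1?eq_sym ?ordS_neq // => _; last first.
  by move: eq_row => /= /set1_inj/(bij_inj (@ordS_bij _)) ->.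
have : (t \in [set s; ordS s]) && (ordS t \in [set s; ordS s]).
  by rewrite -[[set s; _]]eq_row !inE !eqxx orbT.
rewrite !inE => /andP[/orP[/eqP->//|/eqP ->]].
by rewrite (negPf (ordSS_neq s m3)) orFb (inj_eq (bij_inj (@ordS_bij _))) (negPf (ordS_neq s m3)).
Qed.

(** The further rows, labelled by [K], link a block to other parts; they only have to be distinct
    from each other and from the values of [within_row]. *)
Lemma label_rows m (K : finType) : (2 < m)%N -> (2 * m + #|K| <= 2 ^ m)%N ->
  exists2 lab : 'I_m * bool + K -> {set 'I_m},
    injective lab & forall tb, lab (inl tb) = within_row tb.
Proof.
move=> m3 capacity; apply: extend_injection (within_row_inj m3) _; first by move=> ? ? [].
rewrite card_sum card_prod card_bool card_ord mulnC (leq_trans capacity) //.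
by rewrite card_sets card_ord.
Qed.

(** Choose [t] in exactly one of [Y] and [Y']: the product of the two rows has opposite signs at
    these columns. *)
Lemma hadamard_separates (C : numDomainType) m (Y Y' : {set 'I_m}) : (2 < m)%N -> Y != Y' ->
  exists t, let h b := hadamard C (within_row (t, b)) in
    h true Y * h false Y' = - (h true Y' * h false Y).
Proof.
move=> m3 neq.
have [t tY] : exists t, (t \in Y) != (t \in Y').
  apply/existsP; apply: contraR neq => /existsPn eqX; apply/eqP/setP => b.
  by apply/eqP; have := eqX b; rewrite negbK.
exists t => /=; rewrite /within_row /= !hadamard_prod !big_set1.
rewrite !big_setU1 ?inE 1?eq_sym ?ordS_neq //= !big_set1.
move: tY; case: (t \in Y); case: (t \in Y'); case: (ordS t \in Y); case: (ordS t \in Y') => //= _; ring.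
Qed.

End Labels.

Section Design.

Variables (R : realType) (m B rho : nat).

(* Rows and columns are indexed by one block of size [2 ^ m.+1] (the head), [B]
   blocks of size [2 ^ m], and [rho] leftover indices (the tail) on which the
   matrix is the identity. The head has rows enough to be matched with the
   whole tail as well as with every block. *)
Definition site := ({set 'I_m.+1} + 'I_B * {set 'I_m} + 'I_rho)%type.

Definition head_site X : site := inl (inl X).
Definition block_site c X : site := inl (inr (c, X)).
Definition tail_site j : site := inr j.

Definition amp p : R := (Num.sqrt ((2 ^ p)%:R))^-1.

Definition site_mx (x y : site) : R :=
  match x, y with
  | inl (inl X), inl (inl Y) => hadamard R X Y * amp m.+1
  | inl (inr (c, X)), inl (inr (c', Y)) => if c == c' then hadamard R X Y * amp m else 0
  | inr i, inr j => (i == j)%:R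
  | _, _ => 0
  end.

Lemma amp_gt0 p : 0 < amp p.
Proof. by rewrite invr_gt0 sqrtr_gt0 ltr0n expn_gt0. Qed.

Lemma amp_sqr p : amp p * amp p = ((2 ^ p)%:R)^-1.
Proof. by rewrite -invfM -expr2 sqr_sqrtr ?ler0n. Qed.

Lemma card_site : #|{: site}| = (2 ^ m.+1 + B * 2 ^ m + rho)%N.
Proof.
by rewrite !card_sum card_prod !card_sets !card_ord.
Qed.

Lemma sum_hadamard_amp p (X X' : {set 'I_p}) :
  \sum_(Y : {set 'I_p}) (hadamard R X Y * amp p) * (hadamard R X' Y * amp p) = (X == X')%:R.
Proof.
under eq_bigr do rewrite mulrACA amp_sqr.
rewrite -mulr_suml hadamard_orth card_ord natrM mulrAC divff ?mul1r //.
by rewrite pnatr_eq0 expn_eq0.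
Qed.

Lemma big_site (A : Type) (idx : A) (op : Monoid.com_law idx) (F : site -> A) :
  \big[op/idx]_z F z
  = op (op (\big[op/idx]_X F (head_site X)) (\big[op/idx]_c \big[op/idx]_X F (block_site c X)))
       (\big[op/idx]_j F (tail_site j)).
Proof.
rewrite !big_sumType /= pair_bigA; congr (op (op _ _) _).
by apply: eq_bigr => -[].
Qed.

Lemma site_mx_row x (F : site -> R) :
  \sum_z site_mx x z * F z =
  match x with
  | inl (inl X) => \sum_Y hadamard R X Y * amp m.+1 * F (head_site Y)
  | inl (inr (c, X)) => \sum_Y hadamard R X Y * amp m * F (block_site c Y)
  | inr i => F (tail_site i)
  end.
Proof.
rewrite big_site /=; case: x => [[X|[c X]]|i] /=.
- rewrite [X in _ + X]big1 => [|j _]; last by rewrite mul0r.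
  rewrite [X in _ + X + _]big1 => [|c _]; last by rewrite big1 // => Y _; rewrite mul0r.
  by rewrite !addr0.
- rewrite [X in _ + X]big1 => [|j _]; last by rewrite mul0r.
  rewrite [X in X + _ + _]big1 => [|Y _]; last by rewrite mul0r.
  rewrite addr0 add0r (bigD1 c) //= eqxx [X in _ + X]big1 ?addr0 // => c' neq.
  by rewrite big1 // => Y _; rewrite eq_sym (negPf neq) mul0r.
- rewrite [X in X + _ + _]big1 => [|Y _]; last by rewrite mul0r.
  rewrite [X in _ + X + _]big1 => [|c _]; last by rewrite big1 // => Y _; rewrite mul0r.
  rewrite !add0r (bigD1 i) //= eqxx mul1r big1 ?addr0 // => j neq.
  by rewrite eq_sym (negPf neq) mul0r.
Qed.

Lemma site_mx_orth x y : \sum_z site_mx x z * site_mx y z = (x == y)%:R.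
Proof.
have zero (I : finType) (F : I -> R) : \sum_i F i * 0 = 0 by apply: big1 => i _; rewrite mulr0.
rewrite site_mx_row; case: x y => [[X|[c X]]|i] [[Y|[c' Y]]|j] //=.
- exact: sum_hadamard_amp.
- have -> : (inl (inr (c, X)) == inl (inr (c', Y)) :> site) = (c == c') && (X == Y) by [].
  by rewrite (eq_sym c' c); case: (c == c'); rewrite ?sum_hadamard_amp ?zero.
- by rewrite eq_sym.
Qed.

(** Five kinds of row pairs: both rows in the head, both in one block, block with head, block with
    block, tail with head. *)
Definition link := ('I_m.+1 + 'I_B * 'I_m + 'I_B + 'I_B * 'I_B + 'I_rho)%type.

Definition head_label := ('I_m.+1 * bool + ('I_B + 'I_rho))%type.
(** [None] labels the row linked to the head; [Some (c', b)] the row linked to block [c'], where [b]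
    tells whether the present block is the first of the two. *)
Definition block_label := ('I_m * bool + option ('I_B * bool))%type.

Section Rows.

Variables (lab0 : head_label -> {set 'I_m.+1}) (lab1 : block_label -> {set 'I_m}).
Hypotheses (inj0 : injective lab0) (inj1 : injective lab1).
Hypotheses (within0 : forall tb, lab0 (inl tb) = within_row tb).
Hypotheses (within1 : forall tb, lab1 (inl tb) = within_row tb).

(* [link_row (l, false)] and [link_row (l, true)] are to become rows [2j], [2j+1]
   of the final matrix; there is one link for each pair of columns that needs one. *)
Definition link_row (lb : link * bool) : site :=
  let: (l, b) := lb in
  match l with
  | inl (inl (inl (inl t))) => head_site (lab0 (inl (t, b)))
  | inl (inl (inl (inr (c, t)))) => block_site c (lab1 (inl (t, b)))
  | inl (inl (inr c)) => if b then head_site (lab0 (inr (inl c))) else block_site c (lab1 (inr None))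
  | inl (inr (c, c')) => if b then block_site c (lab1 (inr (Some (c', true))))
                              else block_site c' (lab1 (inr (Some (c, false))))
  | inr j => if b then head_site (lab0 (inr (inr j))) else tail_site j
  end.

Lemma link_row_inj : injective link_row.
Proof.
move=> [[[[[t|[c t]]|c]|[c c']]|j] b] [[[[[t2|[c2 t2]]|c2]|[c2 c2']]|j2] b2];
  case: b; case: b2 => //= e; case: e => *; subst;
  do ?[match goal with
       | H : lab0 _ = lab0 _ |- _ => move/inj0: H
       | H : lab1 _ = lab1 _ |- _ => move/inj1: H
       end => H; case: H => *; subst]; try by [].
Qed.

Definition cross_link c c' : link := inl (inr (c, c')).

Definition minor2 u v y y' : R :=
  site_mx u y * site_mx v y' - site_mx u y' * site_mx v y.

(** The threshold is the square of [amp m.+1], a lower bound valid for all kinds of links. *)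
Definition covered y y' := exists l : link,
  (2 * 2 ^ m)%:R^-1 <= `|minor2 (link_row (l, false)) (link_row (l, true)) y y'|.

Lemma covered_sym y y' : covered y y' -> covered y' y.
Proof.
by case=> l le; exists l; rewrite /minor2 -normrN opprB [site_mx _ y' * _]mulrC [X in _ - X]mulrC.
Qed.

Hypothesis m_gt2 : (2 < m)%N.

Lemma amp_succ_sqr : amp m.+1 * amp m.+1 = (2 * 2 ^ m)%:R^-1.
Proof. by rewrite amp_sqr expnS. Qed.

Lemma amp_succ_le : amp m.+1 <= amp m.
Proof.
rewrite lef_pV2 ?posrE ?sqrtr_gt0 ?ltr0n ?expn_gt0 // ler_sqrt ?ler0n //.
by rewrite ler_nat leq_exp2l.
Qed.

Lemma amp_le1 p : amp p <= 1.
Proof.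
rewrite invf_le1 ?sqrtr_gt0 ?ltr0n ?expn_gt0 // -[leLHS]sqrtr1 ler_sqrt ?ler0n //.
by rewrite ler1n expn_gt0.
Qed.

Lemma normr_hadamard_amp p (X Y : {set 'I_p}) q : `|hadamard R X Y * amp q| = amp q.
Proof. by rewrite normrM normr_hadamard mul1r gtr0_norm ?amp_gt0. Qed.

(** By the sign relation the two products of the minor are opposite, so their difference doubles
    instead of cancelling. *)
Lemma separated_minor p (t : 'I_p) (Y Y' : {set 'I_p}) :
  let h b Z := hadamard R (within_row (t, b)) Z * amp p in
  hadamard R (within_row (t, true)) Y * hadamard R (within_row (t, false)) Y'
    = - (hadamard R (within_row (t, true)) Y' * hadamard R (within_row (t, false)) Y) ->
  `|h false Y * h true Y' - h false Y' * h true Y| = 2 * (amp p * amp p).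
Proof.
move=> h sep; have -> : h false Y * h true Y' - h false Y' * h true Y = 2 * (h false Y * h true Y').
  by rewrite /h; ring: sep.
by rewrite (normrM 2) (ger0_norm (ler0n _ 2)) (normrM (h false Y)) !normr_hadamard_amp.
Qed.

Lemma covered_head Y Y' : Y != Y' -> covered (head_site Y) (head_site Y').
Proof.
move=> neq; have [t sep] := hadamard_separates R (leqW m_gt2) neq.
exists (inl (inl (inl (inl t)))); rewrite /minor2 /= !within0 separated_minor //.
by rewrite amp_succ_sqr ler_peMl ?invr_ge0 ?ler0n // ler1n.
Qed.

Lemma covered_block c Y Y' : Y != Y' -> covered (block_site c Y) (block_site c Y').
Proof.
move=> neq; have [t sep] := hadamard_separates R m_gt2 neq.
exists (inl (inl (inl (inr (c, t))))); rewrite /minor2 /= !eqxx !within1 separated_minor //.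
rewrite amp_sqr natrM invfM ler_pM2r ?invr_gt0 ?ltr0n ?expn_gt0 //.
by lra.
Qed.

Lemma covered_head_block c Y Y' : covered (head_site Y) (block_site c Y').
Proof.
exists (inl (inl (inr c))); rewrite /minor2 /= eqxx mul0r sub0r normrN normrM.
rewrite !normr_hadamard_amp -amp_succ_sqr ler_pM2r ?amp_gt0 //.
exact: amp_succ_le.
Qed.

Lemma covered_blocks c c' Y Y' : c != c' -> covered (block_site c Y) (block_site c' Y').
Proof.
move=> neq; exists (cross_link c c'); rewrite /minor2 /= !eqxx (negPf neq) eq_sym (negPf neq).
rewrite mul0r sub0r normrN normrM !normr_hadamard_amp -amp_succ_sqr.
by apply: ler_pM; rewrite ?amp_succ_le // ltW // amp_gt0.
Qed.

Lemma covered_head_tail Y j : covered (head_site Y) (tail_site j).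
Proof.
exists (inr j); rewrite /minor2 /= eqxx mul0r sub0r normrN mul1r.
by rewrite normr_hadamard_amp -amp_succ_sqr ler_piMl ?amp_le1 // ltW ?amp_gt0.
Qed.

Definition is_head (y : site) := if y is inl (inl _) then true else false.
Definition is_tail (y : site) := if y is inr _ then true else false.

Lemma covered_sites y y' : y != y' -> (is_tail y -> is_head y') -> (is_tail y' -> is_head y) ->
  covered y y'.
Proof.
case: y y' => [[Y|[c Y]]|i] [[Y'|[c' Y']]|j] neq ht ht';
  try by [have := ht isT | have := ht' isT].
- by apply: covered_head; apply: contraNneq neq => ->.
- exact: covered_head_block.
- exact: covered_head_tail.
- exact/covered_sym/covered_head_block.
- have [cc'|] := eqVneq c c'; last exact: covered_blocks.
  by rewrite -cc' in neq *; apply: covered_block; apply: contraNneq neq => ->.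
- exact/covered_sym/covered_head_tail.
Qed.

End Rows.

End Design.

(** * Minors of the arranged matrices *)

Lemma normr_det_reindex (R : numDomainType) (T : finType) p (O : T -> T -> R)
    (f r e c : 'I_p -> T) :
  injective f -> injective r -> f @: setT = r @: setT ->
  injective e -> injective c -> e @: setT = c @: setT ->
  `|\det (\matrix_(i, j) O (f i) (e j))| = `|\det (\matrix_(i, j) O (r i) (c j))|.
Proof.
move=> inj_f inj_r fr inj_e inj_c ec.
have [s rE] := same_image_perm inj_f inj_r fr; have [s' cE] := same_image_perm inj_e inj_c ec.
have -> : \matrix_(i, j) O (r i) (c j)
        = row_perm s (col_perm s' (\matrix_(i, j) O (f i) (e j))).
  by apply/matrixP => i j; rewrite !mxE rE cE.
rewrite row_permE col_permE !det_mulmx !det_perm !normrM !normrX !normrN1.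
by rewrite !expr1n mulr1 mul1r.
Qed.

(** Up to sign a minor does not depend on the order of its rows and columns, so any injective
    enumerations may replace the increasing ones. *)
Lemma normr_minor (R : realType) M p (O : 'M[R]_M) (f e : 'I_p -> 'I_M) :
  injective f -> injective e ->
  `|minor_mx O (f @: setT) (e @: setT)| = `|\det (\matrix_(i, j) O (f i) (e j))|.
Proof.
move=> inj_f inj_e.
have : #|f @: setT| = p by rewrite card_imset // cardsT card_ord.
have : #|e @: setT| = p by rewrite card_imset // cardsT card_ord.
(* With the images named, [p] can be replaced by [#|Rs|], the dimension in [minor_mx]. *)
have [S eS] : {S | e @: setT = S} by exists (e @: setT).
have [Rs fR] : {Rs | f @: setT = Rs} by exists (f @: setT).
rewrite /minor_mx eS fR => card_Sp card_R; have card_S : #|S| = #|Rs| by rewrite card_R.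
clear card_Sp; subst p.
pose c (j : 'I_#|Rs|) := nth (enum_val j) (enum S) j.
have [inj_c cS nthE] : [/\ injective c, c @: setT = S
    & forall i j : 'I_#|Rs|, nth (enum_val i) (enum S) j = c j].
  exact: (nth_enum_cover (@enum_val _ (mem Rs)) card_S).
have -> : \matrix_(i < #|Rs|, j < #|Rs|) O (enum_val i) (nth (enum_val i) (enum S) j)
        = \matrix_(i, j) O (enum_val i) (c j).
  by apply/matrixP => i j; rewrite !mxE nthE.
apply: (normr_det_reindex O); rewrite ?cS ?eS ?fR //; first exact: enum_val_inj.
apply/setP => x; apply/imsetP/idP => [[i _ ->]|xR]; first exact: enum_valP.
by exists (enum_rank_in xR x); rewrite ?enum_rankK_in.
Qed.

Section Arrangement.

Variables (R : realType) (m B rho n : nat).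
Local Notation site := (site m B rho).
Variables (lab0 : head_label m B rho -> {set 'I_m.+1}) (lab1 : block_label m B -> {set 'I_m}).
Hypotheses (inj0 : injective lab0) (inj1 : injective lab1).
Hypothesis card_sites : #|{: site}| = (2 * n)%N.

Lemma arrange_rows : exists (row : 'I_(2 * n) -> site) (idx : link m B rho -> 'I_n),
  [/\ injective row, injective idx & forall l b, row (dbl (idx l) b) = link_row lab0 lab1 (l, b)].
Proof.
have inj_link := link_row_inj inj0 inj1.
(* The links provide two distinct sites each, among [2 * n] sites. *)
have le_link : (#|{: link m B rho}| <= n)%N.
  have := leq_card _ inj_link.
  by rewrite card_prod card_bool [leqRHS]card_sites mulnC leq_pmul2l.
pose idx l := widen_ord le_link (enum_rank l).
have inj_idx : injective idx.
  by move=> l l' /(congr1 val) /= /val_inj/enum_rank_inj.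
pose h (lb : link m B rho * bool) := dbl (idx lb.1) lb.2.
have inj_h : injective h.
  by move=> [l b] [l' b'] /dbl_inj[/inj_idx /= -> ->].
have [|row inj_row rowE] := extend_injection inj_h inj_link.
  by rewrite card_ord [leqRHS]card_sites.
exists row, idx; split=> // l b; exact: (rowE (l, b)).
Qed.

Variables (row col : 'I_(2 * n) -> site).
Hypotheses (inj_row : injective row) (inj_col : injective col).

Definition arranged_mx : 'M[R]_(2 * n) := \matrix_(i, a) site_mx R (row i) (col a).

Lemma arranged_mx_orth : orth_mx arranged_mx.
Proof.
apply/matrixP => i j; rewrite !mxE -(inj_eq inj_row) -site_mx_orth.
have bij_col : bijective col by apply: inj_card_bij => //; rewrite card_ord [leqLHS]card_sites.
rewrite (reindex col) /=; last exact: onW_bij.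
by apply: eq_bigr => a _; rewrite !mxE.
Qed.

Variable idx : link m B rho -> 'I_n.
Hypothesis inj_idx : injective idx.
Hypothesis rowE : forall l b, row (dbl (idx l) b) = link_row lab0 lab1 (l, b).

Lemma covered_minor a a' : a != a' -> covered R lab0 lab1 (col a) (col a') ->
  exists Rs, inD 1 Rs /\ (2 * 2 ^ m)%:R^-1 <= `|minor_mx arranged_mx Rs [set a; a']|.
Proof.
move=> neq [l le]; exists (pairset (idx l)); split.
  by exists [set idx l]; rewrite cards1 big_set1.
pose f (i : 'I_2) := dbl (idx l) (i == lift ord0 ord0).
pose e (i : 'I_2) := if i == ord0 then a else a'.
have ord2 (i : 'I_2) : i = ord0 \/ i = lift ord0 ord0.
  by case: i => -[|[|//]] lt; [left|right]; apply: val_inj.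
have inj_f : injective f.
  move=> i j /dbl_inj[_]; by case: (ord2 i) (ord2 j) => -> [] ->.
have inj_e : injective e.
  move=> i j; case: (ord2 i) (ord2 j) => -> [] -> //=; rewrite /e /= => ea;
    by rewrite ea eqxx in neq.
have <- : f @: setT = pairset (idx l).
  apply/setP => x; rewrite inE; apply/imsetP/eqP => [[i _ ->]|/dbl_inE ->].
    by rewrite dbl_half.
  by case: (odd x); [exists (lift ord0 ord0)|exists ord0].
have <- : e @: setT = [set a; a'].
  apply/setP => x; rewrite !inE; apply/imsetP/orP => [[i _ ->]|].
    by rewrite /e; case: ifP; [left|right].
  by case=> /eqP ->; [exists ord0|exists (lift ord0 ord0)].
rewrite normr_minor // (expand_det_row _ ord0) !big_ord_recl big_ord0 addr0 /cofactor.
rewrite !det_mx11 !mxE.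
have -> : lift (lift ord0 ord0) 0 = ord0 :> 'I_2 by apply: val_inj.
rewrite /f /e /= !rowE expr0 expr1 mul1r mulN1r mulrN.
exact: le.
Qed.

Definition block_of (y : site) : option 'I_B := if y is inl (inr (c, _)) then Some c else None.

Lemma site_mx_block c X y : block_of y = Some c -> `|site_mx R (block_site _ c X) y| = amp R m.
Proof. by case: y => [[Y|[c' Y]]|j] //= [->]; rewrite eqxx normr_hadamard_amp. Qed.

Lemma site_mx_off_block c c' X y : block_of y = Some c' -> c != c' ->
  site_mx R (block_site _ c X) y = 0.
Proof. by case: y => [[Y|[d Y]]|j] //= [->] /negPf ->. Qed.

(** Consecutive elements of [S] are paired and the cross links of their blocks taken. Each row then
    meets only the column from its own block, so the submatrix is diagonal with [2 * k] entries of
    modulus [amp m]. *)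
Lemma separated_blocks_minor k (S : {set 'I_(2 * n)}) : #|S| = (2 * k)%N ->
  {in S, forall a, block_of (col a) != None} -> {in S &, injective (block_of \o col)} ->
  exists Rs, inD k Rs /\ ((2 ^ m)%:R^-1) ^+ k <= `|minor_mx arranged_mx Rs S|.
Proof.
move=> card_S blockS injS.
pose e (i : 'I_(2 * k)) : 'I_(2 * n) := enum_val (cast_ord (esym card_S) i).
have eS i : e i \in S by apply: enum_valP.
have inj_e : injective e by move=> i j /enum_val_inj/cast_ord_inj.
have [c cE] : exists c : 'I_(2 * k) -> 'I_B, forall i, block_of (col (e i)) = Some (c i).
  have /fin_all_exists[c cE] : forall i, exists c, block_of (col (e i)) = Some c.
    by move=> i; case E : (block_of _) (blockS _ (eS i)) => [c|//] _; exists c.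
  by exists c.
have inj_c : injective c.
  by move=> i j eq_c; apply/inj_e/injS; rewrite ?eS //= !cE eq_c.
(* [link_row] puts the row [true] into the first block of a cross link; with this order the row
   [dbl (idx (l j)) b] lies in the block of the column [e (dbl j b)]. *)
pose l (j : 'I_k) : link m B rho := cross_link m rho (c (dbl j true)) (c (dbl j false)).
have inj_l : injective l by move=> i j [/inj_c/dbl_inj[]].
have half_lt (i : 'I_(2 * k)) : (i./2 < k)%N by have := ltn_ord i; lia.
pose hf i : 'I_k := Ordinal (half_lt i).
have dblK i : i = dbl (hf i) (odd i) by apply: dbl_inE.
pose f i := dbl (idx (l (hf i))) (odd i).
have inj_f : injective f.
  move=> i j /dbl_inj[/inj_idx/inj_l eq_hf eq_odd].
  by rewrite (dblK i) (dblK j) eq_hf eq_odd.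
have row_f i : exists X, row (f i) = block_site _ (c i) X.
  rewrite /f rowE; move: (hf i) (odd i) (dblK i) => j b ->.
  by case: b; eexists; reflexivity.
exists (f @: setT); split.
  exists [set idx (l j) | j in setT]; split.
    by rewrite card_imset ?cardsT ?card_ord // => i j /inj_idx/inj_l.
  apply/setP => x; apply/imsetP/bigcupP => [[i _ ->]|[_ /imsetP[j _ ->]]].
    by exists (idx (l (hf i))); rewrite ?imset_f // inE dbl_half.
  rewrite inE => /eqP/dbl_inE ->; exists (dbl j (odd x)) => //.
  rewrite /f dbl_odd; congr (dbl (idx (l _)) _).
  by apply: val_inj; rewrite /= -[in LHS](dbl_half j (odd x)).
have -> : S = e @: setT.
  apply/eqP; rewrite eq_sym eqEcard card_imset // cardsT card_ord card_S leqnn andbT.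
  by apply/subsetP => _ /imsetP[i _ ->].
rewrite normr_minor //.
have -> : \matrix_(i, j) arranged_mx (f i) (e j)
        = diag_mx (\row_i site_mx R (row (f i)) (col (e i))).
  apply/matrixP => i j; rewrite !mxE; case: eqVneq => [->|neq]; rewrite ?mulr1n // mulr0n.
  have [X ->] := row_f i; apply: site_mx_off_block (cE j) _.
  by apply: contraNneq neq => /inj_c ->.
rewrite det_diag normr_prod (eq_bigr (fun=> amp R m)) => [|i _]; last first.
  by rewrite !mxE; have [X ->] := row_f i; apply: site_mx_block (cE i).
by rewrite prodr_const card_ord exprM expr2 amp_sqr.
Qed.

End Arrangement.

(** * Separating permutations *)

Section Averaging.

Local Open Scope nat_scope.

Variables (T : finType) (e : rel T).

Definition rel_pairs : nat := \sum_(p : T * T | p.1 != p.2) e p.1 p.2.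

Lemma perm_2transitive (a b a' b' : T) : a != b -> a' != b' ->
  exists2 s : {perm T}, s a = a' & s b = b'.
Proof.
move=> ab ab'; exists (tperm a a' * tperm (tperm a a' b) b')%g; rewrite permM.
  rewrite tpermL tpermD // 1?eq_sym // -[X in X != _](tpermL a a').
  by rewrite (inj_eq perm_inj).
by rewrite tpermL.
Qed.

Lemma sum_distinct_pairs : \sum_(p : T * T | p.1 != p.2) 1 = (#|T| * #|T|.-1)%N.
Proof.
rewrite -(pair_big_dep xpredT (fun a b => a != b) (fun _ _ => 1%N)) /= -sum_nat_const.
apply: eq_bigr => a _; rewrite sum1_card -(cardC1 a).
by apply: eq_card => b; rewrite !inE eq_sym.
Qed.

(** By 2-transitivity the sum over [s] is the same for all pairs of distinct points; summed over
    these pairs, each permutation contributes [rel_pairs]. *)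
Lemma sum_perm_rel (a b : T) : a != b ->
  ((\sum_(s : {perm T}) e (s a) (s b)) * (#|T| * #|T|.-1) = #|{perm T}| * rel_pairs)%N.
Proof.
move=> ab; rewrite -sum_distinct_pairs [LHS]big_distrr /=.
have -> : #|{perm T}| * rel_pairs = \sum_(s : {perm T}) rel_pairs by rewrite sum_nat_const.
transitivity (\sum_(p : T * T | p.1 != p.2) \sum_(s : {perm T}) e (s p.1) (s p.2))%N.
  apply: eq_bigr => -[a' b'] /= ab'; rewrite muln1.
  have [t <- <-] := perm_2transitive ab ab'.
  rewrite (reindex_inj (mulgI t)) /=.
  by apply: eq_bigr => s _; rewrite !permM.
rewrite exchange_big /=; apply: eq_bigr => s _.
rewrite /rel_pairs [RHS](reindex (fun p : T * T => (s p.1, s p.2))) /=.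
  by apply: eq_bigl => p; rewrite (inj_eq perm_inj).
by exists (fun p => (s^-1%g p.1, s^-1%g p.2)) => -[x y] _; rewrite /= ?permK ?permKV.
Qed.

Definition clash (s : {perm T}) (S : {set T}) : bool :=
  [exists p : T * T, [&& p.1 \in S, p.2 \in S, p.1 != p.2 & e (s p.1) (s p.2)]].

(** Union bound: [S] has at most [d ^ 2] pairs, and [sum_perm_rel] gives the share of permutations
    sending a pair into [e]. Not every [s] can exceed the average. *)
Lemma clash_average (F : {set {set T}}) d : {in F, forall S : {set T}, #|S| = d} ->
  exists s, (#|[set S in F | clash s S]| * (#|T| * #|T|.-1) <= #|F| * (d ^ 2 * rel_pairs))%N.
Proof.
move=> cardF; set D := (#|T| * _)%N.
apply/existsP; apply: contraT => /existsPn big.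
have : (#|{perm T}| * (#|F| * (d ^ 2 * rel_pairs)).+1
         <= \sum_(s : {perm T}) #|[set S in F | clash s S]| * D)%N.
  rewrite -[X in X <= _](sum_nat_const {: {perm T}}); apply: leq_sum => s _; by have := big s; rewrite -ltnNge.
have perm_gt0 : (0 < #|{perm T}|)%N by apply/card_gt0P; exists 1%g.
suff : (\sum_(s : {perm T}) #|[set S in F | clash s S]| * D
        <= #|{perm T}| * (#|F| * (d ^ 2 * rel_pairs)))%N.
  by move=> le1 le2; have := leq_trans le2 le1; rewrite leq_pmul2l // ltnn.
have le_clash s S : (clash s S <=
    \sum_(p : T * T | [&& p.1 \in S, p.2 \in S & p.1 != p.2]) e (s p.1) (s p.2))%N.
  case: (boolP (clash s S)) => // /existsP[p /and4P[p1 p2 p12 ep]].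
  by rewrite (bigD1 p) ?p1 ?p2 //= ep.
apply: (@leq_trans (\sum_(s : {perm T}) (\sum_(S in F)
    \sum_(p : T * T | [&& p.1 \in S, p.2 \in S & p.1 != p.2]) e (s p.1) (s p.2)) * D)).
  apply: leq_sum => s _; rewrite leq_mul2r -sum1_card.
  rewrite (eq_bigl (fun S => (S \in F) && clash s S)) => [|S]; last by rewrite inE.
  rewrite big_mkcondr /= leq_sum ?orbT // => S _.
  by apply: leq_trans (le_clash s S); case: (clash s S).
rewrite -big_distrl exchange_big big_distrl /=.
rewrite mulnCA -sum_nat_const leq_sum // => S SF.
rewrite exchange_big big_distrl /=.
rewrite (eq_bigr (fun=> #|{perm T}| * rel_pairs)%N); last first.
  by move=> p /and3P[_ _ ?]; rewrite sum_perm_rel.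
rewrite sum_nat_const mulnCA leq_mul2l -(cardF S SF) leq_mul2r; apply/orP; right.
apply/orP; right; rewrite expnS expn1 -cardsX; apply: subset_leq_card.
by apply/subsetP => p; rewrite !inE => /and3P[-> ->].
Qed.

(* Each step keeps a permutation at most as bad as the average. *)
Lemma clash_greedy (F : {set {set T}}) d N : {in F, forall S : {set T}, #|S| = d} ->
  exists l : seq {perm T}, size l = N /\
   (#|[set S in F | all (clash^~ S) l]| * (#|T| * #|T|.-1) ^ N
     <= #|F| * (d ^ 2 * rel_pairs) ^ N)%N.
Proof.
elim: N F => [|N IH] F cardF.
  exists [::]; split=> //=; rewrite !expn0 !muln1 subset_leq_card //.
  by apply/subsetP => S; rewrite inE andbT.
have [s le_s] := clash_average cardF.
have [|l [size_l le_l]] := IH [set S in F | clash s S].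
  by move=> S; rewrite inE => /andP[/cardF].
exists (s :: l); split; first by rewrite /= size_l.
have -> : [set S in F | all (clash^~ S) (s :: l)]
   = [set S in [set S in F | clash s S] | all (clash^~ S) l].
  by apply/setP => S; rewrite !inE /= andbA.
move: (d ^ 2 * rel_pairs) (#|T| * #|T|.-1) le_s le_l => E D le_s le_l.
rewrite !expnSr mulnA (leq_trans (leq_mul le_l (leqnn _))) //.
by rewrite mulnAC (mulnC (_ ^ N) E) [leqRHS]mulnA leq_mul2r le_s orbT.
Qed.

(** There are at most [#|T| ^ d] sets of size [d]; after [N] greedy steps fewer than one, hence
    none, clashes with every permutation. *)
Lemma clash_free d N :
  (#|T| ^ d * (d ^ 2 * rel_pairs) ^ N < (#|T| * #|T|.-1) ^ N)%N ->
  exists s : 'I_N -> {perm T}, forall S : {set T}, #|S| = d -> exists r, ~~ clash (s r) S.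
Proof.
move=> small; pose F := [set S : {set T} | #|S| == d].
have cardF : {in F, forall S : {set T}, #|S| = d} by move=> S; rewrite inE => /eqP.
have leF : (#|F| <= #|T| ^ d)%N.
  have -> : (#|T| ^ d = #|{ffun 'I_d -> T}|)%N by rewrite card_ffun card_ord.
  apply: leq_trans (leq_imset_card (fun f : {ffun 'I_d -> T} => f @: setT) _).
  apply: subset_leq_card; apply/subsetP => S; rewrite inE => /eqP card_S.
  apply/imsetP; exists [ffun i : 'I_d => enum_val (cast_ord (esym card_S) i)] => //.
  apply/setP => x; apply/idP/imsetP => [xS|[i _ ->]]; last by rewrite ffunE enum_valP.
  exists (cast_ord card_S (enum_rank_in xS x)) => //.
  by rewrite ffunE cast_ordK enum_rankK_in.
have [l [size_l le_l]] := clash_greedy N cardF.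
have no_clash : [set S in F | all (clash^~ S) l] = set0.
  apply/eqP; rewrite -cards_eq0 -leqn0 -ltnS; apply: contraLR small; rewrite -!leqNgt => pos.
  apply: leq_trans (leq_mul leF (leqnn _)); apply: leq_trans le_l.
  by rewrite leq_pmull.
exists (fun r => nth 1%g l r) => S card_S.
have : S \notin [set S in F | all (clash^~ S) l] by rewrite no_clash inE.
rewrite !inE card_S eqxx /= => /allPn[s /(nthP 1%g)[i lt_i <-] nclash].
by rewrite size_l in lt_i; exists (Ordinal lt_i).
Qed.

End Averaging.

(** * Block sizes and the counting of clashes *)

Lemma block_parameters n : (128 <= n)%N -> exists m B rho,
  [/\ (2 < m)%N, (2 ^ m.+1 + B * 2 ^ m + rho = 2 * n)%N, (rho < 2 ^ m)%N,
      ((2 ^ m) ^ 2 <= 32 * n)%N &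
      (2 * m + (2 * B + 1) <= 2 ^ m)%N /\ (2 * m.+1 + (B + rho) <= 2 ^ m.+1)%N].
Proof.
(* With [q = 2 ^ m] this gives [q ^ 2 <= 32 * n < 4 * q ^ 2]. The upper estimate yields [4 * B < q],
   which leaves enough rows in a block for all labels. *)
move=> n_ge; pose m := trunc_log 4 (32 * n).
have sqr4 p : (4 ^ p = (2 ^ p) ^ 2)%N by rewrite -expnM mulnC expnM.
have [le_m] : (4 ^ m <= 32 * n)%N /\ (32 * n < 4 ^ m.+1)%N.
  by apply/andP/trunc_log_bounds; lia.
rewrite expnS !sqr4 => lt_m; rewrite sqr4 in le_m.
have m_ge5 : (5 <= m)%N.
  rewrite leqNgt; apply/negP => m_lt.
  have le_q : (2 ^ m <= 16)%N by rewrite -[16%N]/(2 ^ 4)%N leq_exp2l.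
  by have := leq_mul le_q le_q; rewrite mulnn; lia.
have lin_m p : (5 <= p)%N -> (4 * p + 2 <= 2 ^ p)%N.
  elim: p => // p IH; rewrite leq_eqVlt => /orP[/eqP <- //|]; rewrite ltnS => p5.
  by have := IH p5; rewrite expnS; lia.
have := lin_m m m_ge5; set q := (2 ^ m)%N in le_m lt_m * => lin.
have qS : (2 ^ m.+1 = 2 * q)%N := expnS 2 m; move: le_m lt_m => le_q lt_q.
rewrite -mulnn in le_q lt_q.
have q_le_n : (q <= n)%N.
  by rewrite leqNgt; apply/negP => lt_nq; have := leq_mul (leqnn q) (ltnW lt_nq); nia.
exists m, ((2 * n - 2 * q) %/ q)%N, ((2 * n - 2 * q) %% q)%N; rewrite qS -mulnn -/q; clearbody q m.
have divE := divn_eq (2 * n - 2 * q) q.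
have lt_rho : ((2 * n - 2 * q) %% q < q)%N by rewrite ltn_mod; lia.
move: ((2 * n - 2 * q) %/ q)%N ((2 * n - 2 * q) %% q)%N divE lt_rho => B rho divE lt_rho.
have lt_B : (4 * B < q)%N by nia.
by split; [lia|lia|lia|lia|split; lia].
Qed.

Lemma greedy_inequality (k N n q E : nat) :
  (4 * k < N)%N -> (q ^ 2 <= 32 * n)%N -> (E <= 14 * n * q)%N ->
  ((2 ^ (4 * k) * (56 * k ^ 2) ^ (2 * N)) * 32 ^ N < n)%N ->
  ((2 * n) ^ (2 * k) * ((2 * k) ^ 2 * E) ^ N < (2 * n * (2 * n).-1) ^ N)%N.
Proof.
(* The constant is [14 * (2 * k) ^ 2], with 14 from the bound on [E]. *)
move=> ltN le_q le_E lt_n; set c := (56 * k ^ 2)%N in lt_n.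
have n_gt0 : (0 < n)%N by apply: leq_ltn_trans lt_n.
have leD : ((n * n) ^ N <= (2 * n * (2 * n).-1) ^ N)%N by rewrite leq_exp2r; [nia|lia].
apply: leq_trans leD.
have leE : ((2 * n) ^ (2 * k) * ((2 * k) ^ 2 * E) ^ N <= n ^ N * ((2 * n) ^ (2 * k) * (c * q) ^ N))%N.
  rewrite mulnCA leq_mul2l -expnMn leq_exp2r ?orbT //; last by lia.
  by rewrite /c expnMn; nia.
apply: leq_ltn_trans leE _; clearbody c; rewrite (expnMn n n) ltn_pmul2l ?expn_gt0 ?n_gt0 //.
(* Both sides are squared, so that [q ^ 2 <= 32 * n] applies. *)
rewrite -(ltn_exp2r _ _ (isT : 0 < 2)%N) expnMn -!expnM.
have -> : (2 * k * 2 = 4 * k)%N by lia.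
have le_q2 : (q ^ (2 * N) <= 32 ^ N * n ^ N)%N by rewrite expnM -expnMn leq_exp2r; lia.
(* Here [4 * k < N] enters: it leaves a spare factor [n] to beat the constants. *)
have le_nN : (n * n ^ (4 * k) <= n ^ N)%N by rewrite -expnS leq_pexp2l.
rewrite !expnMn (mulnC N 2).
apply: (@leq_ltn_trans (2 ^ (4 * k) * n ^ (4 * k) * (c ^ (2 * N) * (32 ^ N * n ^ N)))%N).
  by rewrite !leq_mul2l le_q2 !orbT.
have -> : (2 ^ (4 * k) * n ^ (4 * k) * (c ^ (2 * N) * (32 ^ N * n ^ N))
   = (2 ^ (4 * k) * c ^ (2 * N) * 32 ^ N) * n ^ (4 * k) * n ^ N)%N by ring.
have -> : (n ^ (2 * N) = n ^ N * n ^ N)%N by rewrite mulnC expnM expnS expn1.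
rewrite ltn_pmul2r ?expn_gt0 ?n_gt0 //; apply: leq_trans le_nN.
by rewrite ltn_pmul2r ?expn_gt0 ?n_gt0.
Qed.

Section CountClash.

Variables (m B rho : nat).
Local Notation site := (site m B rho).

(** Pairs to be kept apart by the permutations. Head and tail sites clash with everything, since
    [separated_blocks_minor] needs all columns in blocks. *)
Definition same_block (y y' : site) : bool :=
  [|| block_of y == None, block_of y' == None | block_of y == block_of y'].

(** With [q = 2 ^ m], at most [3 * q] sites lie outside the blocks and a block site has at most [q]
    sites in its block; hence [3 + 3 + 1] times [2 * n * q]. *)
Lemma rel_pairs_same_block n : #|{: site}| = (2 * n)%N -> (rho < 2 ^ m)%N ->
  (rel_pairs same_block <= 14 * n * 2 ^ m)%N.
Proof.
move=> card_n lt_rho; set q := (2 ^ m)%N.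
have none_le : (\sum_(y : site) (block_of y == None) <= 3 * q)%N.
  rewrite big_site /= !big1_eq addn0 !sum_nat_const.
  rewrite card_sets !card_ord !muln1 expnS -/q; lia.
have same_le (y : site) : (\sum_(y' : site) ((block_of y != None) && (block_of y == block_of y')) <= q)%N.
  case E : (block_of y) => [c|]; last by rewrite big1.
  rewrite big_site /= !big1_eq addn0 add0n.
  rewrite (bigD1 c) //= eqxx sum_nat_const card_sets card_ord muln1 [X in (_ + X)%N]big1 ?addn0 // => c' neq.
  rewrite big1 // => X _; suff -> : (Some c == Some c') = false by [].
  by apply/eqP => -[cc']; rewrite cc' eqxx in neq.
apply: (@leq_trans (\sum_(y : site) \sum_(y' : site) ((block_of y == None) + (block_of y' == None)
    + ((block_of y != None) && (block_of y == block_of y')))))%N.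
  rewrite pair_bigA /rel_pairs big_mkcond /=; apply: leq_sum => -[y y'] _ /=.
  case: ifP => // _; rewrite /same_block.
  by case: (block_of y == None) => //=; case: (block_of y' == None).
under eq_bigr do rewrite !big_split /= sum_nat_const.
rewrite !big_split /= sum_nat_const -big_distrr /=.
have : (\sum_(y : site) \sum_(y' : site) ((block_of y != None) && (block_of y == block_of y'))
    <= 2 * n * q)%N by rewrite -card_n -sum_nat_const; apply: leq_sum => y _.
move=> le_same; rewrite card_n.
have -> : (14 * n * q = 2 * n * (3 * q) + 2 * n * (3 * q) + 2 * n * q)%N by ring.
by rewrite !leq_add // leq_mul.
Qed.

End CountClash.

(** * The two families of orthogonal matrices *)

Section Construction.

Variables (R : realType) (m B rho n : nat).
Hypothesis m_gt2 : (2 < m)%N.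
Hypothesis card_n : #|{: site m B rho}| = (2 * n)%N.
Hypotheses (capacity1 : (2 * m + (2 * B + 1) <= 2 ^ m)%N)
           (capacity0 : (2 * m.+1 + (B + rho) <= 2 ^ m.+1)%N).

Lemma site_numbering : exists beta : 'I_(2 * n) -> site m B rho, injective beta.
Proof.
exists (fun i => enum_val (cast_ord (esym card_n) i)).
by move=> i j /enum_val_inj/cast_ord_inj.
Qed.

Lemma labels_exist : exists (lab0 : head_label m B rho -> {set 'I_m.+1})
    (lab1 : block_label m B -> {set 'I_m}),
  [/\ injective lab0, injective lab1, forall tb, lab0 (inl tb) = within_row tb
    & forall tb, lab1 (inl tb) = within_row tb].
Proof.
have [|lab0 inj0 w0] := @label_rows m.+1 ('I_B + 'I_rho)%type (leqW m_gt2).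
  by rewrite card_sum !card_ord.
have [|lab1 inj1 w1] := @label_rows m (option ('I_B * bool)) m_gt2.
  by rewrite card_option card_prod card_ord card_bool; move: capacity1; lia.
by exists lab0, lab1.
Qed.

Lemma separated_construction k N :
  ((2 * n) ^ (2 * k) * ((2 * k) ^ 2 * rel_pairs (@same_block m B rho)) ^ N
     < (2 * n * (2 * n).-1) ^ N)%N -> (0 < k)%N ->
  exists O : 'I_N -> 'M[R]_(2 * n), (forall r, orth_mx (O r)) /\
    forall S : {set 'I_(2 * n)}, #|S| = (2 * k)%N ->
      exists r Rs, inD k Rs /\ ((2 ^ m)%:R^-1) ^+ k <= `|minor_mx (O r) Rs S|.
Proof.
move=> small k_gt0; have [beta inj_beta] := site_numbering.
have [lab0 [lab1 [inj0 inj1 w0 w1]]] := labels_exist.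
have [row [idx [inj_row inj_idx rowE]]] := arrange_rows inj0 inj1 card_n.
rewrite -card_n in small; have [s sP] := clash_free small.
pose col r a := s r (beta a).
have inj_col r : injective (col r) by move=> a b /perm_inj/inj_beta.
exists (fun r => arranged_mx R row (col r)); split=> [r|S card_S].
  exact: arranged_mx_orth.
have [|r no_clash] := sP (beta @: S); first by rewrite card_imset.
exists r; apply: (separated_blocks_minor R card_n inj_idx rowE) => //.
- move=> a aS; apply: contraNneq no_clash => none_a.
  (* A clash involves two distinct elements; [0 < k] supplies a second one. *)
  have /card_gt0P[b] : (0 < #|S :\ a|)%N.
    by have := cardsD1 a S; rewrite aS card_S; lia.
  rewrite !inE => /andP[ba bS]; apply/existsP; exists (beta a, beta b) => /=.
  by rewrite !imset_f //= (inj_eq inj_beta) eq_sym ba /same_block none_a eqxx.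
- move=> a b aS bS /= eq_ab; apply/eqP; apply: contraNT no_clash => neq.
  apply/existsP; exists (beta a, beta b) => /=.
  by rewrite !imset_f //= (inj_eq inj_beta) neq /same_block eq_ab eqxx !orbT.
Qed.

(* Only pairs made of a tail column and a non-head column are not covered by the
   base matrix; the second matrix moves the tail columns into the head. *)
Lemma pair_construction :
  exists O : 'I_2 -> 'M[R]_(2 * n), (forall r, orth_mx (O r)) /\
    forall S : {set 'I_(2 * n)}, #|S| = 2 ->
      exists r Rs, inD 1 Rs /\ (2 * 2 ^ m)%:R^-1 <= `|minor_mx (O r) Rs S|.
Proof.
have [beta inj_beta] := site_numbering.
have [lab0 [lab1 [inj0 inj1 w0 w1]]] := labels_exist.
have [row [idx [inj_row inj_idx rowE]]] := arrange_rows inj0 inj1 card_n.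
(* [h] lists all sites outside the head, and [g] fixes the blocks but sends the tail to distinct
   head sites; [phi] extends this rule to all sites. *)
pose h (x : 'I_B * {set 'I_m} + 'I_rho) : site m B rho :=
  match x with inl (c, X) => block_site _ c X | inr j => tail_site _ _ j end.
pose g (x : 'I_B * {set 'I_m} + 'I_rho) : site m B rho :=
  match x with inl (c, X) => block_site _ c X
             | inr j => head_site _ _ (lab0 (inr (inr j))) end.
have inj_h : injective h by case=> [[c X]|i] [[c' X']|j] //= [] => [-> ->|->].
have inj_g : injective g.
  by case=> [[c X]|i] [[c' X']|j] //= [] => [-> ->|/inj0[->]].
have [phi inj_phi phiE] := extend_injection inj_h inj_g (leqnn _).
have phi_tail y : ~~ is_head y -> ~~ is_tail (phi y).
  case: y => [[Y|[c Y]]|j] // _; first by rewrite (phiE (inl (c, Y))).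
  by rewrite (phiE (inr j)).
pose col (r : 'I_2) a := if r == ord0 then beta a else phi (beta a).
have inj_col r : injective (col r).
  by move=> a b; rewrite /col; case: ifP => _ => [|/inj_phi]; apply: inj_beta.
exists (fun r => arranged_mx R row (col r)); split=> [r|S card_S].
  exact: arranged_mx_orth.
have /cards2P[a [b [neq ->]]] : #|S| == 2 by rewrite card_S.
have cover r : (is_tail (col r a) -> is_head (col r b)) ->
    (is_tail (col r b) -> is_head (col r a)) -> exists Rs, inD 1 Rs /\
      (2 * 2 ^ m)%:R^-1 <= `|minor_mx (arranged_mx R row (col r)) Rs [set a; b]|.
  move=> ta tb; apply: (covered_minor rowE neq); apply: covered_sites => //.
  by rewrite (inj_eq (inj_col r)).
(* If one column is in the head, the first matrix covers the pair; otherwise [phi] leaves neither in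
   the tail and the second matrix does. *)
have [ha|nha] := boolP (is_head (beta a)).
  exists ord0; apply: cover; rewrite /col /= ?ha //.
  by case: (beta a) ha => [[]|].
have [hb|nhb] := boolP (is_head (beta b)).
  exists ord0; apply: cover; rewrite /col /= ?hb //.
  by case: (beta b) hb => [[]|].
exists (lift ord0 ord0); apply: cover; rewrite /col /=.
  by move=> t; rewrite (negPf (phi_tail _ nha)) in t.
by move=> t; rewrite (negPf (phi_tail _ nhb)) in t.
Qed.

End Construction.

(** The constant 128 serves both families: [p = 2 ^ m] has square at most [32 * n], and
    [p = 2 * 2 ^ m] at most four times as much. *)
Lemma inv_ge_sqrt (R : realType) (n k p : nat) : (0 < p)%N -> (p ^ 2 <= 128 * n)%N ->
  (Num.sqrt (128 ^+ k))^-1 / Num.sqrt (n%:R ^+ k) <= (p%:R^-1) ^+ k :> R.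
Proof.
move=> p_gt0 le_p.
have n_gt0 : (0 < n)%N by lia.
rewrite -invfM -sqrtrM ?exprn_ge0 ?ler0n // -exprMn exprVn -natrM.
rewrite lef_pV2 ?posrE ?sqrtr_gt0 ?exprn_gt0 ?ltr0n ?muln_gt0 //.
rewrite -[leLHS]ger0_norm ?exprn_ge0 ?ler0n // -sqrtr_sqr ler_sqrt ?exprn_ge0 ?ler0n //.
by rewrite -exprM mulnC exprM lerXn2r ?nnegrE ?exprn_ge0 ?ler0n // -natrX ler_nat.
Qed.

Unset Implicit Arguments.

Theorem theorem1 (R : realType) (k N : nat) :
  (1 <= k)%N -> ((4 * k < N)%N \/ (k = 1%N /\ N = 2%N)) ->
  exists (c c' : R) (n0 : nat), 0 < c /\ 0 < c' /\
    forall n : nat, (n0 <= n)%N -> (1 <= n)%N ->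
      exists O : 'I_N -> 'M[R]_(2 * n),
        (forall r, orth_mx (O r)) /\
        (forall S : {set 'I_(2 * n)}, #|S| = (2 * k)%N ->
           exists (r : 'I_N) (Rs : {set 'I_(2 * n)}),
             inD k Rs /\
             c / Num.sqrt (n%:R ^+ k) <= `|minor_mx (O r) Rs S|) /\
        (forall gamma : 'I_(2 * n) -> 'M[R[i]]_(2 ^ n),
           majorana gamma ->
           exists eta : R,
             c' / Num.sqrt (n%:R ^+ k) <= eta /\ eta <= 1 /\
             povm (Gpar gamma O) /\
             jointly_measures (Gpar gamma O)
               (fun S : {set 'I_(2 * n)} => #|S| == (2 * k)%N)
               (Munsharp gamma eta)).
Proof.
move=> k_gt0 kN; have N_gt0 : (0 < N)%N by lia.
pose c : R := (Num.sqrt (128 ^+ k))^-1.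
have c_gt0 : 0 < c by rewrite invr_gt0 sqrtr_gt0 exprn_gt0 ?ltr0n.
(* The first summand is the threshold of [greedy_inequality], the second that of
   [block_parameters]. *)
pose n0 := ((2 ^ (4 * k) * (56 * k ^ 2) ^ (2 * N) * 32 ^ N).+1 + 128)%N.
exists c, (c / N%:R), n0; split; [|split] => //; first by rewrite divr_gt0 ?ltr0n.
move=> n le_n n_gt0.
(* Only the minors remain to be bounded: the measurement then works with [eta] equal to their lower
   bound divided by [N]. *)
suff [O [orthO largeO]] : exists O : 'I_N -> 'M[R]_(2 * n), (forall r, orth_mx (O r)) /\
    forall S : {set 'I_(2 * n)}, #|S| = (2 * k)%N -> exists r Rs, inD k Rs /\
      c / Num.sqrt (n%:R ^+ k) <= `|minor_mx (O r) Rs S|.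
  exists O; do 2 split=> //; move=> gamma maj.
  have root_ge1 p : (0 < p)%N -> 1 <= Num.sqrt (p%:R ^+ k) :> R.
    by move=> p_gt0; rewrite -[leLHS]sqrtr1 ler_sqrt ?exprn_ge0 ?ler0n // exprn_ege1 // ler1n.
  have root_gt0 : 0 < Num.sqrt (n%:R ^+ k) :> R by apply: lt_le_trans (root_ge1 n n_gt0).
  exists (c / N%:R / Num.sqrt (n%:R ^+ k)); split; [by []|split; [|split]].
  - rewrite -mulrA -invfM ler_pdivrMr ?mulr_gt0 ?ltr0n // mul1r (@le_trans _ _ 1) //.
      by rewrite invf_le1 ?root_ge1 // sqrtr_gt0 exprn_gt0 ?ltr0n.
    by rewrite -[leLHS]mulr1 ler_pM ?ler01 ?ler1n ?root_ge1.
  - exact: povm_Gpar.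
  - apply: joint_measurement => // [|S card_S]; first by rewrite !divr_gt0 ?ltr0n.
    rewrite mulrAC divfK ?pnatr_eq0 -?lt0n //; exact: largeO.
have n_ge : (128 <= n)%N by apply: leq_trans le_n; rewrite leq_addl.
have [m [B [rho [m_gt2 sum_n rho_lt sqr_le [cap1 cap0]]]]] := block_parameters n_ge.
have card_n : #|{: site m B rho}| = (2 * n)%N by rewrite card_site.
have pow_gt0 : (0 < 2 ^ m)%N by rewrite expn_gt0.
case: kN => [ltN|[k1 N2]].
  have [|O [orthO largeO]] := @separated_construction R m B rho n m_gt2 card_n cap1 cap0 k N _ k_gt0.
    apply: (greedy_inequality ltN sqr_le); first exact: rel_pairs_same_block.
    by apply: leq_trans le_n; rewrite leq_addr.
  exists O; split=> // S /largeO[r [Rs [inDRs le]]]; exists r, Rs; split=> //.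
  by apply: le_trans le; apply: inv_ge_sqrt => //; lia.
subst k N; have [O [orthO largeO]] := @pair_construction R m B rho n m_gt2 card_n cap1 cap0.
exists O; split=> // S /largeO[r [Rs [inDRs le]]]; exists r, Rs; split=> //.
apply: le_trans le; rewrite -[leRHS]expr1; apply: inv_ge_sqrt; first by rewrite muln_gt0.
by rewrite expnMn; lia.
Qed.
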